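(* For all non-negative integers $x,y,z,a$, the number of lozenge tilings of the region $\mathcal{E}_{x,y,z}(a)$ equals $E_1(x,y,z,a)$.
   Context: Triangular lattice with horizontal lattice lines. Pentagonal regions here are bounded by a western side and a northeastern side each following a zig-zag lattice path, a horizontal northern side, a straight southeastern side, and a horizontal southern side. For non-negative integers with $y+z\ge 1$, $\mathcal{E}_{x,y,z}(a)$ is obtained from such a pentagon whose western, northern, northeastern, southeastern, southern sides have lengths $y+z+a-1,\ x,\ y+z+2a-1,\ y+z-1,\ x+y+z+3a-2$ by removing the $(y+a)$-th through $(y+2a-1)$-th up-pointing unit triangles on the northeastern side (counting from top to bottom), and then removing the forced lozenges. Pochhammer: $(x)_n=x(x+1)\cdots(x+n-1)$ ($n>0$), $(x)_0=1$, $(x)_{-n}=1/((x-1)\cdots(x-n))$. Skipped Pochhammer: $[x]_n=x(x+2)\cdots(x+2n-2)$ ($n>0$), $[x]_0=1$, $[x]_n=1/((x-2)(x-4)\cdots(x+2n))$ ($n<0$). $E_1(x,0,z,a)= \frac{1}{2^{a+z-2}}\prod_{i=1}^{a-1}\frac{(2x+2i)_i[2x+4i+1]_{i-1}}{(i)_i[2x+2i+1]_{i-1}}\prod_{i=1}^{z-1}\frac{(2x+6a+2i)_i[2x+6a+4i+1]_{i-1}}{(i)_i[2x+6a+2i+1]_{i-1}}$, and for $y>0$ \begin{align*} E_1(x,y,z,a)&= \frac{1}{2^{y+z-1}}\prod_{i=1}^{a}\frac{(2x+2i)_i[2x+4i+1]_{i-1}}{(i)_i[2x+2i+1]_{i-1}}\prod_{i=1}^{y+z-1}\frac{(2x+6a+2i)_i[2x+6a+4i+1]_{i-1}}{(i)_i[2x+6a+2i+1]_{i-1}}\\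 &\times\prod_{i=1}^{a}\frac{(z+i)_{y+a-2i+1}(2x+3y+2z+4a+2i-3)_{y+2a-4i+1}(x+a+i)_{y+a-2i}(2x+3y+3a+3i-3)_{a-i}}{(2i)_{y-1}(y+2z+2i-1)_{y+2a-4i+2}(x+y+z+2a+i-1)_{y+a-2i}(2x+3a+3i)_{a-i}}. \end{align*}
   Formalization: The case y = a = 0 is excluded: there E_1(x,0,z,0) is exactly twice the number of tilings (e.g. x=1, z=2: unit hexagon, 2 tilings, E_1=4). Tilings are counted before removing the forced lozenges, which leaves the number unchanged. *)

(* Defs.v *)
From mathcomp Require Import all_boot all_order all_algebra.
Set Implicit Arguments. Unset Strict Implicit. Unset Printing Implicit Defensive.
Import Order.TTheory GRing.Theory Num.Theory.

(* Triangular lattice with horizontal lattice lines, unit side length.       *)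
(* A unit triangle is encoded by a pair (j, k) of naturals:                  *)
(*   j = its row (it lies between the horizontal lines at heights j, j+1,    *)
(*       heights measured in units of sqrt(3)/2),                            *)
(*   k = twice the abscissa of its centroid.                                 *)
(* In a row, consecutive triangles (k, k+1) alternate orientation; the       *)
(* triangle (j, k) is up-pointing iff j + k is odd.                          *)

Definition tri := (nat * nat)%type.

Definition up_tri (t : tri) : bool := odd (t.1 + t.2).

(* two unit triangles share an edge: horizontally neighbouring triangles in
   the same row share a slanted edge; a down-pointing triangle shares its top
   horizontal edge with the up-pointing triangle right above it. *)
Definition adj_tri (t u : tri) : bool :=
  ((t.1 == u.1) && ((t.2.+1 == u.2) || (u.2.+1 == t.2)))
  || ((t.2 == u.2) && (((t.1.+1 == u.1) && ~~ up_tri t)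
                       || ((u.1.+1 == t.1) && ~~ up_tri u))).

Section Tilings.
Variable N : nat.
Definition wtri := ('I_N * 'I_N)%type.
Definition tri_of (t : wtri) : tri := (val t.1, val t.2).

Definition is_lozenge (B : {set wtri}) : bool :=
  [exists t : wtri, exists u : wtri,
     adj_tri (tri_of t) (tri_of u) && (B == [set t; u])].

Definition lozenge_tiling (R : {set wtri}) (P : {set {set wtri}}) : bool :=
  partition P R && [forall B in P, is_lozenge B].

Definition ntilings (R : {set wtri}) : nat :=
  #|[set P : {set {set wtri}} | lozenge_tiling R P]|.
End Tilings.

(* The pentagon: southwest corner at the origin; height                      *)
(* H = 2(y+z+a-1) rows.  Western side: vertical zig-zag with y+z+a-1 "teeth" *)
(* (each two rows tall), starting from the origin with an up-left step, so   *)
(* the leftmost triangle of every row has k = 0.  Northern side: horizontal  *)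
(* of length x from abscissa 0 to x at height H.  Northeastern side: zig-zag *)
(* going down-right from (x, H), alternating y+z+2a-1 steps "\" with         *)
(* y+z+2a-2 horizontal (east) steps, starting and ending with "\"; it ends at *)
(* height y+z-1.  Southeastern side: straight, of length y+z-1 along the 60  *)
(* degree direction.  Southern side: horizontal of length                    *)
(* S = x+y+z+3a-2.                                                           *)
(* Row j (j < H) of the pentagon consists of the triangles (j, k) with       *)
(*   0 <= k <= 2S + j         if j < y+z-1  (rows along the SE side)         *)
(*   0 <= k <= 2x + 3m        if j = H-1-m, m < y+z+2a-1 (rows along NE side)*)

Definition E_height (y z a : nat) : nat := 2 * (y + z + a) - 2.

Definition E_row_max (x y z a j : nat) : nat :=
  if j.+2 <= y + z then 2 * (x + y + z + 3 * a - 2) + j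
  else 2 * x + 3 * (E_height y z a - 1 - j).

Definition in_pentagon (x y z a : nat) (t : tri) : bool :=
  (t.1 < E_height y z a) && (t.2 <= E_row_max x y z a t.1).

(* the (m+1)-th up-pointing unit triangle on the northeastern side, counted
   from top to bottom (m < y+z+2a-1): the rightmost triangle of row H-1-m *)
Definition NE_up_tri (x y z a m : nat) : tri :=
  (E_height y z a - 1 - m, 2 * x + 3 * m).

Definition removed_tri (x y z a : nat) (t : tri) : bool :=
  [exists m : 'I_(y + 2 * a),
     (y + a <= m.+1 <= y + 2 * a - 1) && (t == NE_up_tri x y z a m)].

Definition E_in_region (x y z a : nat) (t : tri) : bool :=
  in_pentagon x y z a t && ~~ removed_tri x y z a t.

(* a window large enough to contain the region *)
Definition E_window (x y z a : nat) : nat := 4 * (x + y + z + 3 * a) + 1.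

Definition E_region (x y z a : nat) : {set wtri (E_window x y z a)} :=
  [set t | E_in_region x y z a (tri_of t)].

Local Open Scope ring_scope.

Definition poch (x : rat) (n : int) : rat :=
  match n with
  | Posz n => \prod_(i < n) (x + i%:R)
  | Negz n => (\prod_(i < n.+1) (x - (i.+1)%:R))^-1
  end.

Definition spoch (x : rat) (n : int) : rat :=
  match n with
  | Posz n => \prod_(i < n) (x + 2 * i%:R)
  | Negz n => (\prod_(i < n.+1) (x - 2 * (i.+1)%:R))^-1
  end.

Definition E1_fac (X b : rat) (i : nat) : rat :=
  poch (2 * X + b + 2 * i%:R) i%:Z * spoch (2 * X + b + 4 * i%:R + 1) (i%:Z - 1)
  / (poch i%:R i%:Z * spoch (2 * X + b + 2 * i%:R + 1) (i%:Z - 1)).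

Definition E1 (x y z a : nat) : rat :=
  let X : rat := x%:R in let Y : rat := y%:R in
  let Z : rat := z%:R in let A : rat := a%:R in
  let x' : int := x%:Z in let y' : int := y%:Z in
  let z' : int := z%:Z in let a' : int := a%:Z in
  if y == 0%N then
    ((2 : rat) ^ (a' + z' - 2))^-1
    * (\prod_(1 <= i < a) E1_fac X 0 i)
    * (\prod_(1 <= i < z) E1_fac X (6 * A) i)
  else
    ((2 : rat) ^ (y' + z' - 1))^-1
    * (\prod_(1 <= i < a.+1) E1_fac X 0 i)
    * (\prod_(1 <= i < y + z) E1_fac X (6 * A) i)
    * \prod_(1 <= i < a.+1)
        (poch (Z + i%:R) (y' + a' - 2 * i%:Z + 1)
         * poch (2 * X + 3 * Y + 2 * Z + 4 * A + 2 * i%:R - 3)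
                (y' + 2 * a' - 4 * i%:Z + 1)
         * poch (X + A + i%:R) (y' + a' - 2 * i%:Z)
         * poch (2 * X + 3 * Y + 3 * A + 3 * i%:R - 3) (a' - i%:Z)
         / (poch (2 * i%:R) (y' - 1)
            * poch (Y + 2 * Z + 2 * i%:R - 1) (y' + 2 * a' - 4 * i%:Z + 2)
            * poch (X + Y + Z + 2 * A + i%:R - 1) (y' + a' - 2 * i%:Z)
            * poch (2 * X + 3 * A + 3 * i%:R) (a' - i%:Z))).

(* Main.v *)
(* A tiling is the same as a family of n = y + z + a - 1 disjoint lattice paths
   that start on the western side and end on the remaining teeth of the
   northeastern side.  Adding the unit triangles one at a time in reading order
   changes the number of tilings with prescribed frontier exactly as an
   elementary row operation changes a minor, so the number of tilings is
   det [C(x + m + 1 + i, 2 i + 1 - m)], where m runs over the teeth, i.e. over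
   the two blocks 0 <= m < P and q <= m < q + z with P = y + a - 1,
   q = y + 2 a - 1.
   This matrix is A = L U with L lower triangular and, with
   c_r = 2 r (2 x + 2 r + 3) and a_l = (l - 1)(2 x + l + 2),
     U_{r,m} proportional to prod_{l < m} (c_r - a_l) prod_{l > m} (c_r - c_l).
   The inverse of U is Krattenthaler's matrix inverse, and the triangularity of
   A U^-1 is a terminating hypergeometric identity, proved by Zeilberger's
   algorithm.  The first block of columns is then triangular and the second one
   reduces to a Vandermonde determinant; what remains is to compare two
   products through their ratios in z and y. *)
Require Import Defs.
From mathcomp Require Import all_boot all_order all_algebra.
From mathcomp Require Import zify ring lra.
Set Implicit Arguments. Unset Strict Implicit. Unset Printing Implicit Defensive.
Import Order.TTheory GRing.Theory Num.Theory.

(** * Tilings as determinants *)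

(** The paths run through the lozenges that have sides in the direction [\]; they enter through the
    [\] edges of the western side and leave through the remaining [\] edges of the northeastern
    side. They never appear as objects: the induction is over unit triangles, and its statement is
    about every set of crossed frontier edges, not only the teeth. Collisions of paths then show up
    as minors with two equal rows, and no sign-reversing involution is needed. On the algebraic side
    the decisive coincidence is [c_l = a_(2l+1)]. It confines [U_(r,m)] to [r <= m <= 2r+1], which
    matches the vanishing of the binomial matrix for [m > 2i+1]. Column [2i+1] then determines the
    diagonal of [L], so no closed form of [L] has to be known. The Pochhammer symbols of the product
    formula may have negative length. Writing each of them as a quotient of two factorials treats
    both signs at once, and every comparison becomes a cancellation of factorials and double
    factorials. *)

Section Count.
Variable N : nat.
Implicit Types (X : {set wtri N}) (t u : wtri N).

Lemma adj_triC (t u : tri) : adj_tri t u = adj_tri u t.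
Proof.
rewrite /adj_tri [t.1 == u.1]eq_sym [t.2 == u.2]eq_sym.
by rewrite [X in _ && X]orbC [X in _ || _ && X]orbC.
Qed.

Lemma adj_tri_irrefl (t : tri) : adj_tri t t = false.
Proof. by rewrite /adj_tri !eqxx /=; lia. Qed.

Lemma tri_of_inj : injective (@tri_of N).
Proof. by move=> [a b] [c d] [/val_inj -> /val_inj ->]. Qed.

Lemma ntilings_set0 : ntilings (set0 : {set wtri N}) = 1.
Proof.
rewrite /ntilings (_ : [set P | _] = [set set0]) ?cards1 //.
apply/setP => P; rewrite !inE /lozenge_tiling partition_set0.
case: eqP => // ->; apply/forallP => B; by rewrite inE.
Qed.

Lemma ntilings_with X t u : t \in X -> u \in X -> adj_tri (tri_of t) (tri_of u) ->
  #|[set P | lozenge_tiling X P & [set t; u] \in P]| = ntilings (X :\: [set t; u]).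
Proof.
move=> tX uX adj; set B := [set t; u]; set Y := X :\: B.
have sBX : B \subset X by apply/subsetP => v; rewrite !inE => /orP[] /eqP ->.
have XE : X = B :|: Y by rewrite -[LHS](setID X B) (setIidPr sBX).
have B0 : B != set0 by apply/set0Pn; exists t; rewrite !inE eqxx.
have dBY : [disjoint B & Y] by rewrite disjoint_sym disjoints_subset /Y setDE subsetIr.
have lB : is_lozenge B by apply/existsP; exists t; apply/existsP; exists u; rewrite adj eqxx.
have notB (Q : {set {set wtri N}}) : partition Q Y -> B \notin Q.
  move=> pQ; apply/negP => /(partitionS pQ) sBY.
  by have := subsetP sBY t; rewrite !inE eqxx /= => /(_ isT).
rewrite /ntilings -[RHS](@card_in_imset _ _ (fun Q => B |: Q)); last first.
  move=> Q Q'; rewrite !inE => /andP[pQ _] /andP[pQ' _] E.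
  have [nQ nQ'] := (notB _ pQ, notB _ pQ').
  by rewrite -(setU1K nQ) -(setU1K nQ') E.
apply: eq_card => P; rewrite inE; apply/andP/imsetP.
  move=> [/andP[pP lP] BP]; exists (P :\ B); last by rewrite setD1K.
  rewrite inE /lozenge_tiling partitionD1 //=; apply/forall_inP => C.
  by rewrite inE => /andP[_ CP]; exact: (forall_inP lP).
move=> [Q]; rewrite inE => /andP[pQ lQ] ->; split; last by rewrite !inE eqxx.
rewrite /lozenge_tiling {1}XE partitionU1 //=; apply/forall_inP => C.
by rewrite !inE => /orP[/eqP -> //|CQ]; exact: (forall_inP lQ).
Qed.

(** Double counting: a tiling of [X] has exactly one block containing [t], and this block consists
    of [t] and one neighbour. *)
Lemma ntilings_rec X t : t \in X ->
  ntilings X = \sum_(u in X | adj_tri (tri_of t) (tri_of u)) ntilings (X :\: [set t; u]).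
Proof.
move=> tX.
transitivity (\sum_(P | lozenge_tiling X P)
   \sum_(u in X | adj_tri (tri_of t) (tri_of u)) ([set t; u] \in P : nat)).
  rewrite /ntilings -sum1dep_card; apply: eq_bigr => P /andP[pP lP].
  have tP : t \in cover P by rewrite (cover_partition pP).
  have BP := pblock_mem tP; have tB : t \in pblock P t by rewrite mem_pblock.
  have /existsP[v /existsP[w /andP[adj /eqP EB]]] := forall_inP lP _ BP.
  have [u [uX adju EBu]] : exists u, [/\ u \in X, adj_tri (tri_of t) (tri_of u)
      & pblock P t = [set t; u]].
    move: tB; rewrite EB !inE => /orP[] /eqP E.
      exists w; rewrite E; split=> //; apply: (subsetP (partitionS pP BP)).
      by rewrite EB !inE eqxx orbT.
    exists v; rewrite E adj_triC setUC; split=> //; apply: (subsetP (partitionS pP BP)).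
    by rewrite EB !inE eqxx.
  rewrite (bigD1 u) /= ?uX // -EBu BP big1 // => u' /andP[/andP[_ adj'] ne].
  apply/eqP; rewrite eqb0; apply: contra ne => u'P; apply/eqP.
  have := def_pblock (partition_trivIset pP) u'P; move/(_ t); rewrite !inE eqxx.
  move=> /(_ isT); rewrite EBu => /setP/(_ u'); rewrite !inE eqxx orbT.
  by case: eqP => [E|_ /eqP //]; rewrite E adj_tri_irrefl in adj'.
rewrite exchange_big /=; apply: eq_bigr => u /andP[uX adj].
rewrite -ntilings_with // -sum1dep_card [RHS]big_mkcondr.
by apply: eq_bigr => P _; case: (_ \in _).
Qed.

Definition nbrs (t : tri) : seq tri :=
  (t.1, t.2.+1) :: (if t.2 is k.+1 then [:: (t.1, k)] else [::])
  ++ (if up_tri t then if t.1 is j.+1 then [:: (j, t.2)] else [::]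
      else [:: (t.1.+1, t.2)]).

Lemma mem_nbrs (t u : tri) : (u \in nbrs t) = adj_tri t u.
Proof.
case: t u => [j k] [j' k']; rewrite /nbrs /adj_tri /up_tri /=.
case E: (odd (j + k)); case: k E => [|k] E; case: j E => [|j] E;
  rewrite /= ?in_cons ?in_nil ?xpair_eqE /=; lia.
Qed.

Lemma uniq_nbrs t : uniq (nbrs (tri_of t)).
Proof.
case: (tri_of t) => j k; rewrite /nbrs /up_tri /=.
by case: (odd _); case: k => [|k]; case: j => [|j]; rewrite /= ?in_cons ?in_nil ?xpair_eqE /=; lia.
Qed.

Definition tilings_of (p : pred tri) : nat := ntilings [set t : wtri N | p (tri_of t)].

(** The sum runs over the explicit list [nbrs t], so that it can be evaluated by rewriting; the
    bound on [p] puts every possible partner of [t] inside the window. *)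
Lemma tilings_of_rec (p : pred tri) (t : tri) :
  (forall u : tri, p u -> (u.1 < N) && (u.2 < N)) -> p t ->
  tilings_of p = \sum_(u <- nbrs t | p u) tilings_of (fun v : tri => [&& p v, v != t & v != u]).
Proof.
move=> pN pt; have /andP[t1N t2N] := pN _ pt.
pose tw : wtri N := (Ordinal t1N, Ordinal t2N).
have Et : tri_of tw = t by rewrite [RHS]surjective_pairing.
rewrite /tilings_of (@ntilings_rec _ tw) ?inE ?Et //.
have -> : \sum_(u in [set t0 | p (tri_of t0)] | adj_tri t (tri_of u))
     ntilings ([set t0 | p (tri_of t0)] :\: [set tw; u]) =
   \sum_(u : wtri N | (p (tri_of u)) && (tri_of u \in nbrs t))
     tilings_of (fun v : tri => [&& p v, v != t & v != tri_of u]).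
  apply: eq_big => [u|u _]; first by rewrite inE mem_nbrs.
  congr ntilings; apply/setP => v; rewrite !inE -Et !(inj_eq tri_of_inj).
  by rewrite negb_or andbC.
rewrite -(big_map (@tri_of N) (fun u : tri => p u && (u \in nbrs t))
  (fun u : tri => tilings_of (fun v : tri => [&& p v, v != t & v != u]))) /=.
rewrite -big_filter -[RHS]big_filter; apply: perm_big; apply: uniq_perm.
- by rewrite filter_uniq // map_inj_uniq ?index_enum_uniq //; exact: tri_of_inj.
- by rewrite filter_uniq // -Et uniq_nbrs.
move=> u; rewrite !mem_filter -andbA; case pu: (p u) => //=.
case un: (u \in nbrs t) => //=; have /andP[u1 u2] := pN _ pu.
by apply/mapP; exists (Ordinal u1, Ordinal u2); rewrite ?mem_index_enum // [LHS]surjective_pairing.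
Qed.
End Count.

Lemma eq_tilings_of N (p q : pred tri) : p =1 q -> tilings_of N p = tilings_of N q.
Proof.
by move=> epq; congr ntilings; apply/setP => t; rewrite !inE epq.
Qed.

(** * Adding one unit triangle to the processed part of a region *)

Section Position.
Variable n : nat.

(* Reading the frontier of a set of processed triangles from the top of the
   western side to the right numbers its edges; [pos t] is the number of the
   upper edge of a down-pointing [t] and of the right edge of an up-pointing
   [t], so that passing a triangle keeps the numbering of the other edges. *)
Definition pos (t : tri) : nat := (n.*2.-1 - t.1 + t.2)./2.

Lemma pos_right j i : j < n.*2 -> up_tri (j, i) -> pos (j, i.+1) = pos (j, i).
Proof. by rewrite /pos /up_tri /=; lia. Qed.

Lemma pos_left J k : J < n.*2 -> up_tri (J, k.+1) -> pos (J, k.+1) = (pos (J, k)).+1.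
Proof. by rewrite /pos /up_tri /=; lia. Qed.

Lemma pos_below J k : J.+1 < n.*2 -> up_tri (J.+1, k) -> pos (J, k) = pos (J.+1, k).
Proof. by rewrite /pos /up_tri /=; lia. Qed.

End Position.

Section Transfer.
Variables (N n : nat) (K : nat -> nat).
Hypothesis le_nN : n.*2 <= N.
Hypothesis lt_KN : forall j, j < n.*2 -> K j < N.
Hypothesis K_below : forall j k,
  j.+1 < n.*2 -> odd (j.+1 + k) -> k <= K j.+1 -> k <= K j.

Notation pos := (pos n).

Definition rows (t : tri) : bool := (t.1 < n.*2) && (t.2 <= K t.1).

Definition before (J k : nat) (t : tri) : bool :=
  rows t && ((t.1 < J) || (t.1 == J) && (t.2 < k)).

(* [S] is the set of frontier edges crossed by paths.  A down-pointing triangle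
   under a crossed edge is covered from above, and an up-pointing triangle left
   of a slanted edge that is not crossed is covered from the right: both are
   left out of the region. *)
Definition trimmed (p : pred tri) (S : pred nat) (t : tri) : bool :=
  p t && (if up_tri t then p (t.1, t.2.+1) || S (pos t)
          else p (t.1.+1, t.2) || ~~ S (pos t)).

(* A path starts in every even row, and none enters from the southern side. *)
Definition valid (p : pred tri) (S : pred nat) : bool :=
  [forall i : 'I_n, p (i.*2, 0) || S (n.-1 - i)] &&
  [forall k : 'I_(K 0).+1, odd k ==> p (0, val k) || ~~ S (pos (0, val k))].

Definition state (p : pred tri) (S : pred nat) : nat :=
  if valid p S then tilings_of N (trimmed p S) else 0.

Lemma trimmed_bound (p : pred tri) (S : pred nat) : (forall t, p t -> rows t) ->
  forall t : tri, trimmed p S t -> (t.1 < N) && (t.2 < N).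
Proof.
move=> pR t /andP[/pR /andP[t1 t2] _].
by rewrite (leq_trans t1 le_nN) (leq_ltn_trans t2 (lt_KN t1)).
Qed.

Lemma before_rows J k (t : tri) : before J k t -> rows t. Proof. by case/andP. Qed.

Lemma beforeS J k (t : tri) : before J k.+1 t = before J k t || (t == (J, k)) && rows t.
Proof.
case: t => j i; rewrite /before xpair_eqE /=; case: (rows _) => //=; lia.
Qed.

Lemma valid_down J k S : rows (J, k) -> ~~ up_tri (J, k) ->
  valid (before J k) S = valid (before J k.+1) S && ((k == 0) ==> S (pos (J, k))).
Proof.
move=> Rt; rewrite /up_tri /= => ev; rewrite /valid.
rewrite [RHS]andbAC; congr (_ && _); last first.
  apply: eq_forallb => i; case oi: (odd i) => //=; rewrite beforeS.
  by rewrite (_ : (_ == (J, k)) = false) ?orbF //= xpair_eqE; apply/negP => /andP[/eqP E /eqP F]; move: ev; rewrite -E -F oi.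
apply/forallP/andP => [H|[/forallP H Sk] i].
  split.
    by apply/forallP => i; have := H i; rewrite beforeS => /orP[->|->]; rewrite ?orbT.
  apply/implyP => /eqP k0; have /andP[/= J2n _] := Rt.
  have Jn : J./2 < n by lia.
  have := H (Ordinal Jn); rewrite /before /= (_ : J./2.*2 = J) ?ltnn ?k0 ?andbF /=; last by lia.
  by rewrite (_ : pos _ = n.-1 - J./2) // /pos /=; lia.
have := H i; rewrite beforeS -orbA => /or3P[-> //| |Hs]; last by rewrite Hs orbT.
rewrite xpair_eqE => /andP[/andP[/eqP E /eqP k0] _]; apply/orP; right.
by have := implyP Sk (introT eqP (esym k0)); rewrite -k0; congr (is_true (S _)); rewrite /pos /=; lia.
Qed.

(** The left edge of a down-pointing triangle hands its number over to the upper edge, so the same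
    [S] describes both frontiers. If the edge is crossed, the triangle is reserved for a lozenge
    reaching upwards. If not, its only available partner is the left neighbour, which was reserved
    for it before; for [k = 0] there is no partner, and [valid] fails on the other side. *)
Lemma state_down J k S : rows (J, k) -> ~~ up_tri (J, k) ->
  state (before J k.+1) S = state (before J k) S.
Proof.
move=> Rt dt; have pt : before J k.+1 (J, k) by rewrite beforeS eqxx Rt orbT.
have npt : before J k (J, k) = false by rewrite /before /=; lia.
have pS (c : tri) : c != (J, k) -> before J k.+1 c = before J k c.
  by move=> /negPf ne; rewrite beforeS ne orbF.
have right0 : before J k.+1 (J, k.+1) = false by rewrite /before /=; lia.
have above0 : before J k.+1 (J.+1, k) = false.
  by rewrite /before /=; lia.
have up_above (c : tri) : ~~ up_tri c -> (c.1.+1, c.2) != (J, k).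
  move=> dc; apply: contra dt => /eqP <-; move: dc; rewrite /up_tri /=; lia.
rewrite /state (valid_down S Rt dt); case S_t: (S (pos (J, k))).
  rewrite implybT andbT; case: ifP => // _; apply: eq_tilings_of => c.
  rewrite /trimmed; have [->|ne] := eqVneq c (J, k).
    by rewrite npt (negPf dt) above0 S_t andbF.
  rewrite pS //; case: ifP => [uc|/negbT dc]; last by rewrite pS ?up_above.
  have [E|ne'] := eqVneq (c.1, c.2.+1) (J, k); last by rewrite pS.
  rewrite E; have -> : pos c = pos (J, k).
    case: c uc E {ne} => j i uc [Ej Ek]; rewrite -Ej -Ek pos_right //.
    by have /andP[/= + _] := Rt; rewrite Ej.
  by rewrite S_t !orbT.
case: k Rt dt pt npt pS right0 above0 up_above S_t
  => [|k] Rt dt pt npt pS right0 above0 up_above S_t; rewrite implybF.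
  rewrite eqxx andbF; case: ifP => // _.
  rewrite (@tilings_of_rec _ _ (J, 0)); first last.
  - by rewrite /trimmed pt (negPf dt) S_t orbT.
  - by apply: trimmed_bound => c; exact: before_rows.
  rewrite /nbrs /= (negPf dt) /= !big_cons big_nil.
  by rewrite /trimmed right0 above0.
rewrite andbT; case: ifP => // _.
have left_in : before J k.+2 (J, k).
  by move: pt; rewrite /before /rows /=; lia.
have upl : up_tri (J, k) by move: dt; rewrite /up_tri /=; lia.
have /andP[/= J2n _] := Rt.
rewrite (@tilings_of_rec _ _ (J, k.+1)); first last.
- by rewrite /trimmed pt (negPf dt) S_t orbT.
- by apply: trimmed_bound => c; exact: before_rows.
rewrite /nbrs /= (negPf dt) /= !big_cons big_nil /trimmed right0 above0 left_in upl pt /= addn0.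
apply: eq_tilings_of => c; have [->|ne] := eqVneq c (J, k.+1).
  by rewrite npt /= andbF.
have [->|nl] := eqVneq c (J, k).
  rewrite upl npt /= -(pos_right J2n upl) S_t andbF.
  by rewrite !andbF.
rewrite pS // !andbT; congr (_ && _); case: ifP => [uc|/negbT dc]; last by rewrite pS ?up_above.
by rewrite pS.
Qed.
(** [K_below] is applied row after row along the diagonal [i - j = k + 1 - J]. Triangles on one such
    diagonal share their position up to rounding, so this controls which of them can touch the
    frontier. *)
Lemma rows_chain J k j i : rows (J, k) -> up_tri (J, k) -> j < J ->
  i + J = k + j.+1 -> i <= K j.
Proof.
move=> /andP[/= J2n kK]; rewrite /up_tri /= => uJ lt_jJ.
have [d Ed] : exists d, J = j + d.+1 by exists (J - j.+1); lia.
elim: d j i lt_jJ Ed => [|d IH] j i lt_jJ Ed E; subst.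
  by apply: K_below; [lia | lia | rewrite -addn1; have -> : i = k by lia].
have {}IH : i.+1 <= K j.+1 by apply: IH; lia.
by apply: K_below; lia.
Qed.

(* Apart from the two lower neighbours of the new triangle, no frontier
   triangle has one of the two positions involved in the step. *)
Lemma off_frontier J k c : rows (J, k.+1) -> up_tri (J, k.+1) ->
  before J k.+1 c -> c != (J, k) -> (J == c.1.+1) && (c.2 == k.+1) = false ->
  (pos c == pos (J, k.+1)) || (pos c == pos (J, k)) ->
  if up_tri c then before J k.+1 (c.1, c.2.+1) else before J k.+1 (c.1.+1, c.2).
Proof.
move=> RJ uJ; have := rows_chain RJ uJ; move/andP: RJ uJ => [/= J2n kK].
case: c => j i; rewrite /up_tri /before /rows /pos xpair_eqE /= => uJ ch.
move=> /andP[/andP[j2n iK] bef] ne nb Epos; case: ifP => par.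
  have [Ej|ne_j] := eqVneq j J; first by clear ch Epos nb ne; subst; lia.
  have lt_jJ : j < J by clear -bef ne_j; lia.
  rewrite j2n lt_jJ /= andbT.
  have [E|E] : i + J = k + j.+1 \/ i.+2 + J = k + j.+1.
    by clear -uJ par Epos j2n J2n; lia.
    by apply: ch => //; clear -E; lia.
  by apply: leq_trans (ch j i.+3 lt_jJ _) => //; clear -E; lia.
have Ei : i + J = k + j \/ i + J = k + j.+2.
  by clear -uJ par Epos j2n J2n; lia.
have [Ej|ne_j] := eqVneq j J; first by clear -Ej bef ne Ei; subst; lia.
have [Ej|ne_j1] := eqVneq j.+1 J.
  by clear -J2n kK nb Ei Ej; subst; lia.
have lt_jJ : j.+1 < J by clear -bef ne_j ne_j1; lia.
rewrite (ltn_trans lt_jJ J2n) lt_jJ /= andbT.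
case: Ei => E.
  by apply: leq_trans (ch j.+1 i.+3 lt_jJ _); rewrite ?leqW //; clear -E; lia.
by apply: leq_trans (ch j.+1 i.+1 lt_jJ _) => //; clear -E; lia.
Qed.

Definition moved (S : pred nat) (r : nat) : pred nat :=
  fun q => (q == r) || S q && (q != r.+1).

Lemma valid_up J k S : rows (J, k) -> up_tri (J, k) ->
  valid (before J k) S = valid (before J k.+1) S && ((J == 0) ==> ~~ S (pos (J, k))).
Proof.
move=> Rt; rewrite /up_tri /= => ut; rewrite /valid -andbA; congr (_ && _).
  apply: eq_forallb => i; congr (_ || _); rewrite beforeS.
  rewrite (_ : (_ == (J, k)) = false) ?orbF // xpair_eqE; apply/negP => /andP[/eqP E /eqP F].
  by move: ut; rewrite -E -F addn0 odd_double.
apply/forallP/andP => [H|[/forallP H Sk] i].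
  split.
    apply/forallP => i; apply/implyP => oi; have := implyP (H i) oi.
    by rewrite beforeS => /orP[->|->]; rewrite ?orbT.
  apply/implyP => /eqP J0; subst J; have /andP[/= _ kK] := Rt.
  have := implyP (H (Ordinal (kK : k < (K 0).+1))) ut.
  by rewrite /before /= ltnn andbF.
apply/implyP => oi; have := implyP (H i) oi; rewrite beforeS -orbA => /or3P[-> //| |Hs]; last by rewrite Hs orbT.
rewrite xpair_eqE => /andP[/andP[/eqP J0 /eqP k0] _]; apply/orP; right.
by have := implyP Sk (introT eqP (esym J0)); rewrite -J0 -k0.
Qed.

(** The two numbers changed by the move differ from those of all western edges not yet processed. In
    the bottom row, the southern edge under the new triangle carries no condition once the triangle
    is processed; before that, the move leaves it uncrossed. *)
Lemma valid_moved J k (S : pred nat) : rows (J, k.+1) -> up_tri (J, k.+1) -> S (pos (J, k.+1)) ->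
  valid (before J k.+1) (moved S (pos (J, k))) = valid (before J k.+2) S.
Proof.
move=> Rt; rewrite /up_tri /= => ut S1; have /andP[/= J2n kK] := Rt.
rewrite /valid /moved; congr (_ && _).
  apply: eq_forallb => i; rewrite [in RHS]beforeS.
  rewrite (_ : (_ == (J, k.+1)) = false) ?xpair_eqE ?andbF // orbF.
  have := ltn_ord i; case: (ltnP J i.*2) => [lt_Ji|le_iJ] lt_in; last first.
    have -> : before J k.+1 (i.*2, 0); last by [].
    rewrite /before /rows /=; lia.
  have -> : (n.-1 - i == pos (J, k)) = false by rewrite /pos /=; lia.
  have -> : (n.-1 - i != (pos (J, k)).+1) = true by rewrite /pos /=; lia.
  by rewrite andbT.
apply: eq_forallb => i; case oi: (odd i) => //=; rewrite [in RHS]beforeS.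
have [E|ne] := eqVneq (0, val i) (J, k.+1).
  rewrite E Rt !orbT /=.
  have -> : (pos (J, k.+1) == pos (J, k)) = false by rewrite /pos /=; lia.
  have -> : (pos (J, k.+1) != (pos (J, k)).+1) = false by rewrite /pos /=; lia.
  by rewrite andbF orbT.
rewrite orbF; case: (posnP J) => [J0|J0]; last first.
  by have -> : before J k.+1 (0, val i); first by
    rewrite /before /rows /=; have := ltn_ord i; lia.
subst J; case: (ltnP i k.+1) => [lt_ik|le_ki].
  by have -> : before 0 k.+1 (0, val i); first by
    rewrite /before /rows /=; have := ltn_ord i; lia.
have {}ne : nat_of_ord i != k.+1 by move: ne; rewrite xpair_eqE.
have -> : (pos (0, val i) == pos (0, k)) = false by rewrite /pos /=; lia.
have -> : (pos (0, val i) != (pos (0, k)).+1) = true by rewrite /pos /=; lia.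
by rewrite andbT.
Qed.

Section Up.
Variables (J k : nat).
Hypotheses (Rt : rows (J, k)) (ut : up_tri (J, k)).
Let p := before J k.
Let p' := before J k.+1.

Let pt : p' (J, k). Proof. by rewrite /p' beforeS eqxx Rt orbT. Qed.
Let npt : p (J, k) = false. Proof. by rewrite /p /before /=; lia. Qed.
Let pS c : c != (J, k) -> p' c = p c.
Proof. by move=> /negPf ne; rewrite /p' beforeS ne orbF. Qed.
Let right0 : p' (J, k.+1) = false. Proof. by rewrite /p' /before /=; lia. Qed.
Let right_ne c : up_tri c -> (c.1, c.2.+1) != (J, k).
Proof. by move=> uc; apply: contraTneq ut => <-; move: uc; rewrite /up_tri /=; lia. Qed.

Lemma trimmed_up_out (S : pred nat) c : S (pos (J, k)) = false -> trimmed p' S c = trimmed p S c.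
Proof.
move=> S_t; rewrite /trimmed; have [->|ne] := eqVneq c (J, k).
  by rewrite npt ut right0 S_t andbF.
rewrite pS //; case uc: (up_tri c); first by rewrite pS ?right_ne.
have [E|ne'] := eqVneq (c.1.+1, c.2) (J, k); last by rewrite pS.
congr (_ && _); suff -> : pos c = pos (J, k) by rewrite S_t !orbT.
have /andP[/= J2n _] := Rt; move: J2n ut; case: E => <- <- J2n uc'.
by rewrite -pos_below //; case: (c).
Qed.

Lemma trimmed_up_below (S : pred nat) c : S (pos (J, k)) -> 0 < J ->
  [&& trimmed p' S c, c != (J, k) & c != (J.-1, k)] = trimmed p S c.
Proof.
move=> S_t J0; rewrite /trimmed; have [->|ne] := eqVneq c (J, k).
  by rewrite npt andbF.
have /andP[/= J2n _] := Rt.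
have Eb : pos (J.-1, k) = pos (J, k).
  by move: J2n ut J0; case: (J) => // J' J2n uc' _; rewrite -pos_below.
have ub : up_tri (J.-1, k) = false by move: ut J0; rewrite /up_tri /=; lia.
have [->|nb] := eqVneq c (J.-1, k).
  by rewrite ub /= prednK // npt Eb S_t !andbF.
rewrite !andbT pS //; case uc: (up_tri c); first by rewrite pS ?right_ne.
rewrite pS //; apply: contra nb => /eqP[<- <-] /=.
by case: (c).
Qed.

(** With [r = pos (J, k')], crossing [r] reserves the left neighbour and so removes it from the
    smaller region, while vacating [r.+1] keeps the triangle below the new one. By [off_frontier] no
    other frontier triangle has one of these two numbers. *)
Lemma trimmed_up_left (S : pred nat) c k' : k = k'.+1 -> S (pos (J, k)) ->
  S (pos (J, k')) = false ->
  [&& trimmed p' S c, c != (J, k) & c != (J, k')] = trimmed p (moved S (pos (J, k'))) c.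
Proof.
move=> Ek S_t S_l; rewrite /trimmed; have [->|ne] := eqVneq c (J, k).
  by rewrite npt andbF.
have /andP[/= J2n kK] := Rt.
have dl : up_tri (J, k') = false.
  by move: ut; rewrite Ek /up_tri /= addnS /= => /negPf.
have [->|nl] := eqVneq c (J, k').
  rewrite !andbF dl /moved eqxx /= (_ : p (J.+1, k') = false) ?andbF //.
  by rewrite /p /before /= ltnNge leqnSn (gtn_eqF (ltnSn J)) andbF.
have Er : pos (J, k) = (pos (J, k')).+1 by rewrite Ek pos_left // -Ek.
rewrite !andbT pS //; case pc: (p c) => //=.
have [nb|nb] := boolP ((J == c.1.+1) && (c.2 == k)).
  have {}nb : (c.1.+1, c.2) = (J, k) by case/andP: nb => /eqP -> /eqP ->.
  have dc : up_tri c = false.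
    by move: ut; rewrite -nb /up_tri /= => /negPf.
  have -> : pos c = pos (J, k).
    move: J2n ut; case: nb => <- <- J2n uc'; rewrite -pos_below //; by case: (c).
  by rewrite dc nb pt npt /moved Er eqxx andbF orbF /= (gtn_eqF (ltnSn _)).
have [near|far] := boolP ((pos c == pos (J, k)) || (pos c == pos (J, k'))).
  have := @off_frontier J k' c; rewrite -Ek => /(_ Rt ut pc nl (negPf nb) near).
  rewrite -/p; case: ifP => uc pn; rewrite pn ?orTb.
    by rewrite pS ?pn // right_ne.
  rewrite pS ?pn //; apply: contra nb => /eqP [<- <-]; by rewrite !eqxx.
have -> : moved S (pos (J, k')) (pos c) = S (pos c).
  by move: far; rewrite negb_or Er /moved => /andP[/negPf -> /negPf ->]; rewrite andbT.
case: ifP => uc; first by rewrite pS // right_ne.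
by rewrite pS //; apply: contra nb => /eqP [<- <-]; rewrite !eqxx.
Qed.

(** A crossed right edge forbids a partner on the right, so the new triangle is matched below or to
    the left. The left neighbour is available only when its upper edge is not crossed, since
    otherwise it is itself reserved. *)
Lemma tilings_up (S : pred nat) : S (pos (J, k)) ->
  tilings_of N (trimmed p' S) = (0 < J) * tilings_of N (trimmed p S)
  + (if k is k'.+1 then ~~ S (pos (J, k')) * tilings_of N (trimmed p (moved S (pos (J, k'))))
     else 0).
Proof.
move=> S_t; have /andP[/= J2n kK] := Rt.
rewrite (@tilings_of_rec _ _ (J, k)); first last.
- by rewrite /trimmed pt ut S_t orbT.
- by apply: trimmed_bound => c; exact: before_rows.
rewrite /nbrs /= ut big_cons {1}/trimmed right0 /= big_cat /= addnC; congr (_ + _).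
  case: (posnP J) => J0.
    by rewrite {1}J0 big_nil.
  have -> : (if J is j.+1 then [:: (j, k)] else [::]) = [:: (J.-1, k)] by case: (J) J0.
  have below_in : trimmed p' S (J.-1, k).
    have ub : up_tri (J.-1, k) = false by move: ut J0; rewrite /up_tri /=; lia.
    have kb : k <= K J.-1.
      by have := @K_below J.-1 k; rewrite prednK //; apply.
    rewrite /trimmed ub /= prednK // pt andbT /p' /before /rows /= kb andbT.
    by rewrite (leq_ltn_trans (leq_pred _) J2n) ltn_predL J0.
  rewrite big_cons big_nil below_in mul1n addn0; apply: eq_tilings_of => c.
  exact: trimmed_up_below.
case Ek: k => [|k']; first by rewrite big_nil.
have dl : up_tri (J, k') = false.
  by move: ut; rewrite Ek /up_tri /= addnS /= => /negPf.
have e1 : p' (J, k').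
  by rewrite /p' /before /rows /= J2n ltnn eqxx /= (leq_trans (leqnSn _)) -?Ek //= ltnS Ek leqnSn.
have e2 : p' (J.+1, k') = false.
  by rewrite /p' /before /= ltnNge leqnSn (gtn_eqF (ltnSn J)) andbF.
have left_in : trimmed p' S (J, k') = ~~ S (pos (J, k')) by rewrite /trimmed dl e1 e2.
rewrite big_cons big_nil left_in addn0; case S_l: (S (pos (J, k'))); rewrite ?mul0n ?mul1n //.
by apply: eq_tilings_of => c; rewrite -(trimmed_up_left c Ek S_t S_l) Ek.
Qed.

Lemma state_up0 (S : pred nat) : k = 0 -> state p' S = state p S.
Proof.
move=> k0; rewrite /state (valid_up S Rt ut); case: (boolP (S _)) => S_t; last first.
  rewrite implybT andbT; case: ifP => // _; apply: eq_tilings_of => c.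
  exact: trimmed_up_out (negPf S_t).
have := tilings_up S_t; rewrite [X in _ + X](_ : _ = 0); last by rewrite k0.
move=> ->; rewrite addn0 implybF eqn0Ngt.
by case: (0 < J); rewrite /= ?mul1n ?andbT ?andbF ?if_same.
Qed.

Lemma state_upS k' (S : pred nat) : k = k'.+1 -> state p' S = state p S
  + (S (pos (J, k)) && ~~ S (pos (J, k'))) * state p (moved S (pos (J, k'))).
Proof.
move=> Ek; rewrite /state (valid_up S Rt ut); case: (boolP (S _)) => S_t; last first.
  rewrite implybT andbT mul0n addn0; case: ifP => // _; apply: eq_tilings_of => c.
  exact: trimmed_up_out (negPf S_t).
have -> : valid p (moved S (pos (J, k'))) = valid p' S.
  by rewrite /p /p'; move: Rt ut S_t; rewrite Ek; exact: valid_moved.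
have := tilings_up S_t; rewrite [X in _ + X](_ : _ = ~~ S (pos (J, k'))
  * tilings_of N (trimmed p (moved S (pos (J, k'))))); last by rewrite Ek.
move=> ->; rewrite implybF eqn0Ngt.
case: (valid p' S); rewrite ?muln0 //=.
by case: (0 < J); rewrite /= ?mul1n ?mul0n.
Qed.
End Up.
End Transfer.

Lemma eq_state N n K p p' S S' : p =1 p' -> S =1 S' ->
  state N n K p S = state N n K p' S'.
Proof.
move=> ep eS; rewrite /state /valid.
have -> : [forall i : 'I_n, p (i.*2, 0) || S (n.-1 - i)] =
    [forall i : 'I_n, p' (i.*2, 0) || S' (n.-1 - i)].
  by apply: eq_forallb => i; rewrite ep eS.
have -> : [forall k : 'I_(K 0).+1, odd k ==> p (0, val k) || ~~ S (pos n (0, val k))] =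
    [forall k : 'I_(K 0).+1, odd k ==> p' (0, val k) || ~~ S' (pos n (0, val k))].
  by apply: eq_forallb => i; rewrite ep eS.
by case: ifP => // _; apply: eq_tilings_of => c; rewrite /trimmed !ep eS.
Qed.

(** * Tiling counts as minors *)

Section Determinants.
Variables (N n : nat) (K : nat -> nat).
Hypothesis le_nN : n.*2 <= N.
Hypothesis lt_KN : forall j, j < n.*2 -> K j < N.
Hypothesis K_below : forall j k,
  j.+1 < n.*2 -> odd (j.+1 + k) -> k <= K j.+1 -> k <= K j.

Definition occupied (s : 'I_n -> nat) : pred nat := fun q => [exists i, s i == q].

Definition minor (Phi : nat -> nat -> rat) (s : 'I_n -> nat) : rat :=
  (\det (\matrix_(i < n, c < n) Phi (s i) c))%R.

Definition cell_step (J k : nat) (Phi : nat -> nat -> rat) (r c : nat) : rat :=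
  if [&& up_tri (J, k), 0 < k & r == pos n (J, k)] then (Phi r c + Phi r.-1 c)%R
  else Phi r c.

(** The invariant covers all sets of [n] crossed edges, since a step moves one crossing. The bound
    is the number of the last edge of the initial frontier, made of [n] western and [(K 0).+1./2]
    southern edges. *)
Definition counts (J k : nat) (Phi : nat -> nat -> rat) : Prop :=
  forall s : 'I_n -> nat, {homo s : i j / i < j} ->
  (forall i, s i <= n.-1 + (K 0).+1./2) ->
  ((state N n K (before n K J k) (occupied s))%:R = minor Phi s)%R.

Lemma incr_id (s : 'I_n -> nat) : {homo s : i j / i < j} -> (forall i, s i < n) ->
  forall i, s i = i.
Proof.
move=> incr_s lt_s i; apply/eqP; rewrite eqn_leq; apply/andP; split.
  have [d] := ubnP (n - i); elim: d i => // d IH i le_d.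
  have [lt_i|le_i] := ltnP i.+1 n; last by have := lt_s i; lia.
  have := IH (Ordinal lt_i); have := incr_s i (Ordinal lt_i) (ltnSn i) => /=; lia.
have [d] := ubnP i; elim: d i => // d IH i le_d.
case: (posnP i) => [-> //|i0]; have lt_i : i.-1 < n by have := ltn_ord i; lia.
have := IH (Ordinal lt_i); have := incr_s (Ordinal lt_i) i => /=; lia.
Qed.

(** For the empty region only the [n] western edges may be crossed. Any other choice crosses a
    southern edge, and the corresponding minor of the identity has a zero row. *)
Lemma counts_init : counts 0 0 (fun r c => (r == c)%:R)%R.
Proof.
move=> s incr_s bound_s.
have b0 : before n K 0 0 =1 pred0 by move=> c; rewrite /before !ltn0 andbF /= andbF.
rewrite (eq_state _ _ _ b0 (frefl _)) /state.
have [lt_s|/existsP[i0 le_ns]] := boolP [forall i, s i < n].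
  have sE := incr_id incr_s (fun i => forallP lt_s i).
  have -> : valid n K pred0 (occupied s).
    apply/andP; split; apply/forallP => i /=.
      apply/existsP; have lt_i : n.-1 - i < n by have := ltn_ord i; lia.
      by exists (Ordinal lt_i); rewrite sE.
    apply/implyP => oi; apply/existsP => -[j /eqP]; rewrite sE /pos /=.
    by have := ltn_ord j; lia.
  rewrite (_ : tilings_of N _ = 1); last first.
    by apply: etrans (ntilings_set0 N); congr (ntilings _).
  rewrite /minor (_ : \matrix_(_, _) _ = 1%:M)%R ?det1 //.
  by apply/matrixP => i c; rewrite !mxE sE.
rewrite -leqNgt in le_ns; have -> : valid n K pred0 (occupied s) = false.
  apply/negbTE; rewrite negb_and; apply/orP; right; rewrite negb_forall; apply/existsP.
  (* This is the column of the up-pointing triangle of the bottom row whose southern edge has the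
     number [s i0]. *)
  have lt_k : 2 * (s i0 - n) + 1 < (K 0).+1 by have := bound_s i0; have := ltn_ord i0; lia.
  exists (Ordinal lt_k); rewrite /= negb_imply negbK; apply/andP; split; first by lia.
  apply/existsP; exists i0; rewrite /pos /=; apply/eqP; lia.
rewrite /minor (expand_det_row _ i0) big1 // => c _; rewrite mxE (gtn_eqF _) ?mul0r //.
exact: leq_trans (ltn_ord c) le_ns.
Qed.

(** The two terms of [state_upS] are the two terms of the determinant expanded by linearity in the
    modified row. *)
Lemma counts_cell J k Phi : rows n K (J, k) -> counts J k Phi ->
  counts J k.+1 (cell_step J k Phi).
Proof.
move=> Rt cnt s incr_s bound_s; have /andP[/= J2n kK] := Rt.
have same : [&& up_tri (J, k), 0 < k & occupied s (pos n (J, k))] = false ->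
    minor (cell_step J k Phi) s = minor Phi s.
  move=> no; rewrite /minor; congr (\det _)%R; apply/matrixP => i c; rewrite !mxE /cell_step.
  case: ifP => // /and3P[u k0 /eqP Er]; case/negP: (negbT no); rewrite u k0 /=.
  by apply/existsP; exists i; rewrite Er.
have [ut|dt] := boolP (up_tri (J, k)); last first.
  by rewrite state_down // cnt // same // (negPf dt).
case Ek: k => [|k'].
  subst k; rewrite (state_up0 le_nN lt_KN K_below Rt ut) // cnt // same //.
  by rewrite ltnn andbF.
have Er : pos n (J, k) = (pos n (J, k')).+1 by rewrite Ek pos_left // -Ek.
rewrite -Ek (state_upS le_nN lt_KN K_below Rt ut _ Ek).
have [/existsP[i0 /eqP Ei0]|S_t] := boolP (occupied s _); last first.
  by rewrite mul0n addn0 cnt // same // (negPf S_t) !andbF.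
set r := pos n (J, k') in Er *.
pose s' i := if i == i0 then r else s i.
have injs : injective s.
  move=> i j Eij; apply: val_inj; case: (ltngtP i j) => // lt_ij.
    by have := incr_s _ _ lt_ij; rewrite Eij ltnn.
  by have := incr_s _ _ lt_ij; rewrite Eij ltnn.
have minorE : minor (cell_step J k Phi) s = (minor Phi s + minor Phi s')%R.
  rewrite /minor -[X in (X + _)%R]mul1r -[X in (_ + X)%R]mul1r.
  apply: (determinant_multilinear (i0 := i0)).
  - apply/rowP => c; rewrite !mxE !mul1r /cell_step ut Ek /= -Ek Ei0 eqxx /s' eqxx.
    by rewrite Er.
  - apply/matrixP => i c; rewrite !mxE /cell_step -Ei0 (inj_eq injs).
    by rewrite eq_sym (negPf (neq_lift _ _)) !andbF.
  - apply/matrixP => i c; rewrite !mxE /cell_step -Ei0 (inj_eq injs) /s'.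
    by rewrite eq_sym (negPf (neq_lift _ _)) !andbF.
rewrite minorE natrD natrM cnt //; congr (_ + _)%R.
(* If [r] is crossed already, the second minor has two equal rows, in agreement with the vanishing
   coefficient in [state_upS]. If not, replacing [r.+1] by [r] keeps [s] increasing, because no
   integer lies strictly between them. *)
have [/existsP[i1 /eqP Ei1]|S_l] := boolP (occupied s r).
  rewrite mul0r /minor; apply/esym/(determinant_alternate (i1 := i0) (i2 := i1)).
    by apply: contraTneq isT => E; move: Ei1; rewrite -E Ei0 Er; lia.
  move=> c; rewrite !mxE /s' eqxx; case: ifP => // _; by rewrite Ei1.
rewrite mul1r -cnt.
- congr (_%:R)%R; apply: eq_state => // q; rewrite /moved /occupied.
  apply/idP/existsP.
    case/orP => [/eqP ->|/andP[/existsP[i /eqP Ei] ne]].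
      by exists i0; rewrite /s' eqxx.
    exists i; rewrite /s'; case: (eqVneq i i0) => [E|_]; last by rewrite Ei.
    by case/negP: ne; rewrite -Ei E Ei0 Er.
  case=> i; rewrite /s'; case: (eqVneq i i0) => [_ /eqP <-|ne /eqP <-]; first by rewrite eqxx.
  apply/orP; right; rewrite -Er -Ei0 (inj_eq injs) ne andbT.
  by apply/existsP; exists i.
- move=> i j lt_ij; rewrite /s'; have := incr_s _ _ lt_ij.
  case: (eqVneq i i0) => [->|nei]; case: (eqVneq j i0) => [->|nej] //; rewrite ?ltnn ?Ei0 ?Er //; try lia.
  rewrite ltnS leq_eqVlt => /orP[/eqP E|//]; case/negP: S_l.
  by apply/existsP; exists i; rewrite E.
- by move=> i; rewrite /s'; case: ifP => // _; have := bound_s i0; rewrite Ei0 Er; lia.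
Qed.

Fixpoint row_counts (J : nat) (Phi : nat -> nat -> rat) (k : nat) : nat -> nat -> rat :=
  if k is k'.+1 then cell_step J k' (row_counts J Phi k') else Phi.

Fixpoint path_counts (J : nat) : nat -> nat -> rat :=
  if J is J'.+1 then row_counts J' (path_counts J') (K J').+1
  else fun r c => ((r == c)%:R)%R.

Lemma counts_path J : J <= n.*2 -> counts J 0 (path_counts J).
Proof.
elim: J => [|J IH] le_J; first exact: counts_init.
have cnt k : k <= (K J).+1 -> counts J k (row_counts J (path_counts J) k).
  elim: k => [|k IHk] le_k; first by apply: IH; exact: ltnW.
  by apply: counts_cell; [rewrite /rows /= le_J | apply: IHk; exact: ltnW].
move=> s incr_s bound_s; rewrite -(cnt _ (leqnn _) s incr_s bound_s); congr (_%:R)%R.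
apply: eq_state => // -[j k]; rewrite /before /rows /=.
by case: (eqVneq j J) => [->|ne]; lia.
Qed.

Lemma tilings_trimmed (s : 'I_n -> nat) : {homo s : i j / i < j} ->
  (forall i, s i <= n.-1 + (K 0).+1./2) ->
  ((tilings_of N (trimmed n (rows n K) (occupied s)))%:R = minor (path_counts n.*2) s)%R.
Proof.
move=> incr_s bound_s; rewrite -counts_path //; congr (_%:R)%R.
have E : before n K n.*2 0 =1 rows n K by move=> c; rewrite /before /rows; lia.
rewrite (eq_state _ _ _ E (frefl _)) /state ifT //.
apply/andP; split; apply/forallP => i; rewrite /rows /=.
  by rewrite ltn_double ltn_ord.
apply/implyP => _; case: (posnP n) => [n0|n0]; last by have := ltn_ord i; lia.
apply/orP; right; apply/existsP => -[j]; have := ltn_ord j; lia.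
Qed.
End Determinants.

(** * Path counts as binomial coefficients *)

Section ClosedForm.
Variables (n : nat) (K : nat -> nat).
Hypothesis K_below : forall j k,
  j.+1 < n.*2 -> odd (j.+1 + k) -> k <= K j.+1 -> k <= K j.

(** Lattice paths not limited on the right: path [c] starts in row [(n.-1 - c).*2] at position [c],
    then makes [r - c] moves to the right and climbs to row [j.-1]. Before the start row is
    processed only the identity entry is present. *)
Definition free_count (j r c : nat) : nat :=
  if j <= (n.-1 - c).*2 then (r == c : nat)
  else if c <= r then 'C(r - c + (j.-1 - (n.-1 - c).*2), j.-1 - (n.-1 - c).*2) else 0.

Lemma free_count_stable j r c : c < n -> r.*2.+1 + j <= n.*2 ->
  free_count j.+1 r c = free_count j r c.
Proof.
move=> lt_c le_r; rewrite /free_count.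
case: (ltngtP r c) => [lt_rc|lt_cr|<-].
- by do 2 case: ifP => //.
- by rewrite !ifT //; lia.
rewrite subnn !add0n !binn.
by do 2 case: ifP => //.
Qed.

Lemma free_count_pascal j r c : c < n -> j < n.*2 -> n.*2 < r.*2.+1 + j ->
  free_count j.+1 r c = free_count j r c + free_count j.+1 r.-1 c.
Proof.
move=> lt_c lt_j le_r; rewrite /free_count.
have [le_i|lt_i] := leqP j.+1 (n.-1 - c).*2.
  rewrite ifT; last by lia.
  by rewrite (_ : (r.-1 == c) = false) ?addn0 //; lia.
have [le_i|lt_i'] := leqP j (n.-1 - c).*2.
  have -> : j.+1.-1 - (n.-1 - c).*2 = 0 by lia.
  by rewrite !bin0; case: (ltngtP r c) => [||<-] *; do ?case: ifP; lia.
have [q Eq] : exists q, j.-1 - (n.-1 - c).*2 = q by exists (j.-1 - (n.-1 - c).*2).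
have -> : j.+1.-1 - (n.-1 - c).*2 = q.+1 by lia.
rewrite Eq; case: (ltngtP r c) => [lt_rc|lt_cr|Erc].
- by rewrite ifF //; lia.
- rewrite ifT; last by lia.
  have -> : r.-1 - c + q.+1 = r - c + q by lia.
  by rewrite addnS binS addnC.
subst r; rewrite subnn !add0n !binn ifF //; lia.
Qed.

(** In row [J] the position [r] belongs to the up-pointing triangle of column [r.*2.+1 + J - n.*2];
    the test decides whether this column has been passed. The hypothesis on [r] says that this
    column does not exceed the right end of the row. *)
Lemma row_counts_closed J k r c : c < n -> J < n.*2 -> r.*2.+1 + J <= n.*2 + K J ->
  (forall r, r.*2.+1 + J <= n.*2 + K J ->
     path_counts n K J r c = (free_count J r c)%:R%R) ->
  row_counts n J (path_counts n K J) k r c =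
  ((if (r.*2.+1 + J < n.*2 + k)%N then free_count J.+1 r c else free_count J r c)%:R)%R.
Proof.
move=> lt_c lt_J; elim: k r => [|k IH] r live H /=.
  rewrite H //; case: ifP => // lt_r; rewrite free_count_stable //; lia.
rewrite /cell_step; case: ifP => [/and3P[u k0 /eqP Er]|no].
  have Ek : r.*2.+1 + J = n.*2 + k by move: u Er; rewrite /up_tri /pos /=; lia.
  have e1 : (r.*2.+1 + J < n.*2 + k) = false by lia.
  have e2 : (r.-1.*2.+1 + J < n.*2 + k) = true by lia.
  have e3 : (r.*2.+1 + J < n.*2 + k.+1) = true by lia.
  rewrite !IH ?e1 ?e2 ?e3 //; last by lia.
  by rewrite -natrD -free_count_pascal //; lia.
rewrite IH //; have [Ek|ne] := eqVneq (r.*2.+1 + J) (n.*2 + k).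
  have e1 : (r.*2.+1 + J < n.*2 + k) = false by lia.
  have e3 : (r.*2.+1 + J < n.*2 + k.+1) = true by lia.
  rewrite e1 e3 free_count_stable //; move: no; rewrite /up_tri /pos /=; lia.
by congr (_%:R)%R; case: ifP; case: ifP => //; lia.
Qed.

Lemma path_counts_closed J r c : c < n -> J < n.*2 -> r.*2.+1 + J <= n.*2 + K J ->
  path_counts n K J r c = (free_count J r c)%:R%R.
Proof.
move=> lt_c; elim: J r => [|J IH] r lt_J live; first by rewrite /free_count.
rewrite -[path_counts n K J.+1]/(row_counts n J (path_counts n K J) (K J).+1).
have live' : r.*2.+1 + J <= n.*2 + K J.
  have [lt_r|le_r] := ltnP (r.*2.+2 + J) n.*2; first by lia.
  by have := @K_below J (r.*2.+2 + J - n.*2) lt_J; lia.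
rewrite row_counts_closed ?ifT //; try by lia.
by move=> r' live_r'; apply: IH; lia.
Qed.

Lemma path_countsS_closed J r c : c < n -> J < n.*2 -> r.*2.+1 + J <= n.*2 + K J ->
  path_counts n K J.+1 r c = (free_count J.+1 r c)%:R%R.
Proof.
move=> lt_c lt_J live.
rewrite -[path_counts n K J.+1]/(row_counts n J (path_counts n K J) (K J).+1).
rewrite row_counts_closed ?ifT //; first by lia.
by move=> r' live'; apply: path_counts_closed.
Qed.

Lemma path_counts_dead J J' r c : J <= J' ->
  (forall j, J <= j < J' -> n.*2 + K j < r.*2.+1 + j) -> J' <= n.*2 ->
  path_counts n K J' r c = path_counts n K J r c.
Proof.
move=> le_J dead le_n; have [d Ed] : exists d, J' = J + d by exists (J' - J); lia.
subst J'; elim: d {le_J} dead le_n => [|d IH] dead le_n; first by rewrite addn0.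
rewrite addnS -IH; try by lia.
  rewrite -[path_counts n K _.+1]/(row_counts n (J + d) (path_counts n K (J + d)) (K (J + d)).+1).
  have : (K (J + d)).+1 <= (K (J + d)).+1 by [].
  elim: {1 3}(K (J + d)).+1 => //= k IHk le_k; rewrite /cell_step ifF; first by apply: IHk; lia.
  apply/negP => /and3P[u k0 /eqP Er]; have := dead (J + d).
  move: u Er; rewrite /up_tri /pos /=; lia.
by move=> j lt_j; apply: dead; lia.
Qed.
End ClosedForm.

Local Open Scope ring_scope.

(** * The hypergeometric identity *)

(** With the value 0 at negative integers, [invfactS] holds for every integer, so the identities
    below need no case analysis on the support of the binomial coefficients. *)
Definition invfact (k : int) : rat := if k is Posz n then (n`!)%:R^-1 else 0.

Lemma fact_neq0 n : (n`!)%:R != 0 :> rat.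
Proof. by rewrite pnatr_eq0 -lt0n fact_gt0. Qed.

Lemma invfactS (k : int) : (k + 1)%:~R * invfact (k + 1) = invfact k.
Proof.
case: k => [n|[|n]] //=; last first.
  by rewrite NegzE (_ : - n.+2%:Z + 1 = Negz n) ?mulr0 // NegzE; lia.
rewrite -PoszD addn1 /= factS natrM invfM mulrA.
by rewrite -[n.+1%:~R]/(n.+1%:R : rat) divff ?mul1r // pnatr_eq0.
Qed.

Lemma invfactS' (k l : int) : k + 1 = l -> invfact k = l%:~R * invfact l.
Proof. by move=> <-; rewrite invfactS. Qed.

Definition pathmx (x i m : nat) : rat :=
  if (m <= i.*2.+1)%N then 'C(x + m + 1 + i, i.*2.+1 - m)%:R else 0.

(** The row index is extended to integers so that the recurrence can start at [i = -1]; from there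
    on the argument of [absz] is non-negative. *)
Definition pathmxz (x : nat) (i : int) (m : nat) : rat :=
  ((absz (x%:Z + m%:Z + 1 + i))`!)%:R
  * invfact (2 * i + 1 - m%:Z) * invfact (x%:Z + 2 * m%:Z - i).

Lemma pathmxzE x (i m : nat) : pathmxz x i%:Z m = pathmx x i m.
Proof.
rewrite /pathmxz /pathmx; case: leqP => [le_mi | lt_im]; last first.
  by case E: (2 * _ + 1 - _)%R => [n|n] /=; rewrite ?mulr0 ?mul0r //; lia.
have [le_ix | lt_xi] := leqP i (x + 2 * m); last first.
  case E: (_ + 2 * m%:Z - _)%R => [n|n] /=; first lia.
  by rewrite mulr0 bin_small //; lia.
rewrite (_ : 2 * i%:Z + 1 - m%:Z = (i.*2.+1 - m)%N); last lia.
rewrite (_ : x%:Z + 2 * m%:Z - i%:Z = (x + 2 * m - i)%N); last lia.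
rewrite (_ : absz _ = x + m + 1 + i)%N /=; last lia.
rewrite -(@bin_fact (x + m + 1 + i) (i.*2.+1 - m)); last lia.
rewrite (_ : _ - (_ - _) = x + 2 * m - i)%N; last lia.
rewrite !natrM; field; by rewrite !fact_neq0.
Qed.

Section Hypergeometric.
Variable x : nat.
Let X : rat := x%:R.

Definition ccoef (l : nat) : rat := 2 * l%:R * (2 * X + 2 * l%:R + 3).
Definition acoef (l : nat) : rat := (l%:R - 1) * (2 * X + l%:R + 2).

(** This makes [phi m (c r)] vanish for [m > 2r + 1], the bound beyond which row [r] of [pathmx]
    vanishes as well. *)
Lemma ccoef_acoef l : ccoef l = acoef (2 * l + 1).
Proof. by rewrite /ccoef /acoef natrD natrM; ring. Qed.

Lemma ccoef_sub_acoef r l : ccoef r - acoef l =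
  (2 * r%:R + 1 - l%:R) * (2 * X + 2 * r%:R + l%:R + 2).
Proof. by rewrite /ccoef /acoef; ring. Qed.

Lemma ccoef_sub r l : ccoef r - ccoef l =
  2 * (r%:R - l%:R) * (2 * X + 2 * r%:R + 2 * l%:R + 3).
Proof. by rewrite /ccoef; ring. Qed.

Lemma ccoef_inj : injective ccoef.
Proof.
move=> r l /eqP; rewrite -subr_eq0 ccoef_sub !mulf_eq0 subr_eq0 eqr_nat.
case/orP => [/orP[//|/eqP //]|].
rewrite /X -!natrM -!natrD pnatr_eq0; lia.
Qed.

Lemma ccoef_sub_acoef_neq0 r l : l != r.*2.+1 -> ccoef r - acoef l != 0.
Proof.
move=> ne; rewrite ccoef_sub_acoef mulf_neq0 //.
  rewrite -natrM -(natrD _ _ 1) subr_eq0 eqr_nat; lia.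
by rewrite /X -!natrM -!natrD pnatr_eq0; lia.
Qed.

(** Up to the factor [c m - a m] and a scalar depending on [p], the entry [(m, p)] of the inverse of
    the matrix [phi m (c r)]. *)
Definition wprod (p m : nat) : rat :=
  \prod_(0 <= l < m) (ccoef p - ccoef l)
  * \prod_(m.+1 <= l < p.+1) (ccoef p - acoef l).

Lemma wprodS p m : (m < p)%N ->
  wprod p m.+1 * (ccoef p - acoef m.+1) = wprod p m * (ccoef p - ccoef m).
Proof.
move=> lt_mp; rewrite /wprod big_nat_recr //= (@big_ltn _ _ _ m.+1) //; ring.
Qed.

(** The weight that remains when [c m - a m = (m + 1)(2x + 3m + 2)] times [wprod p m] is divided by
    the column scale [gcoef m]. *)
Definition ptail (p : nat) (m : nat) : rat :=
  (-1) ^+ m * ((x + m)`!)%:R / (m`!)%:R * wprod p m.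

Lemma ptailS p m : (m < p)%N ->
  ptail p m.+1 * ((m%:R + 1) * (ccoef p - acoef m.+1))
  = - ptail p m * ((X + m%:R + 1) * (ccoef p - ccoef m)).
Proof.
move=> /wprodS ww; rewrite /ptail exprS addnS !factS !natrM.
transitivity (- ((-1) ^+ m * ((x + m).+1%:R * (x + m)`!%:R) / ((m`!)%:R))
  * (wprod p m.+1 * (ccoef p - acoef m.+1))).
  rewrite -[m.+1%:R]natr1; field.
  by rewrite fact_neq0 ?nat1r ?natr1 pnatr_eq0.
rewrite ww -[(x + m).+1%:R]natr1 natrD /X; field; exact: fact_neq0.
Qed.

Definition Ssum (p : nat) (i : int) : rat :=
  \sum_(0 <= m < p.+1) ptail p m * pathmxz x i m.

Lemma Ssum_lin p (i j k : int) (u v w : rat) :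
  u * Ssum p i + v * Ssum p j + w * Ssum p k =
  \sum_(0 <= m < p.+1) ptail p m
    * (u * pathmxz x i m + v * pathmxz x j m + w * pathmxz x k m).
Proof.
rewrite /Ssum !mulr_sumr -!big_split; apply: eq_bigr => m _ /=.
move: (ptail p m) (pathmxz x i m) (pathmxz x j m) (pathmxz x k m) => *; ring.
Qed.

(* Found, with the certificate [b m * s m], by Zeilberger's algorithm; the
   index starts at [-1], where the sum vanishes trivially. *)
Lemma Ssum_rec p (i : int) : -1 <= i ->
  (X + i%:~R + 2) * (- ccoef p + 3 * i%:~R + i%:~R ^+ 2 - 3 * X - X ^+ 2)
    * Ssum p i
  + (60 - 12 * ccoef p + 104 * i%:~R - 5 * i%:~R * ccoef p + 52 * i%:~R ^+ 2
     + 8 * i%:~R ^+ 3 - 10 * X - 4 * X * ccoef p + 18 * X * i%:~R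
     + 8 * X * i%:~R ^+ 2 - 22 * X ^+ 2 - 4 * X ^+ 2 * i%:~R - 4 * X ^+ 3)
    * Ssum p (i + 1)
  + 2 * (2 * i%:~R + 5)
    * (2 * (i%:~R + 2) * (2 * X + 2 * i%:~R + 7) - ccoef p) * Ssum p (i + 2)
  = 0.
Proof.
move=> i_ge; set c := ccoef p; set I : rat := i%:~R.
(* The common factor of [pathmxz] at [i], [i + 1] and [i + 2]: each of the three is a polynomial
   multiple of it. *)
pose Abar m : rat := ((absz (x%:Z + m%:Z + 1 + i))`!)%:R
  * invfact (2 * i + 5 - m%:Z) * invfact (x%:Z + 2 * m%:Z - i).
pose s (m : nat) : rat := 2 + I + 15 * X + 6 * X * I + 2 * X ^+ 2 + (3 * X + 9 * I + 22) * m%:R.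
pose b (m : nat) : rat := m%:R * (X + 2 * m%:R - 1 - I) * (X + 2 * m%:R - I)
   * (c - acoef m).
pose a (m : nat) : rat := - (X + m%:R + 1) * (X + m%:R + 2 + I) * (2 * I + 5 - m%:R)
   * (c - ccoef m).
pose G m := ptail p m * Abar m * b m * s m.
(* For [m < p] this is [G m.+1] expressed without division through the terms at [m]. It still makes
   sense at [m = p], where [a] vanishes; [G 0] vanishes through the factor [m] of [b], so the
   telescoped sum is zero. *)
pose G' m := ptail p m * Abar m * a m * s m.+1.
have GG m : (m < p)%N -> G' m = G m.+1.
  move=> lt_mp; rewrite /G /G' /b.
  transitivity ((ptail p m.+1 * ((m%:R + 1) * (c - acoef m.+1)))
      * (Abar m.+1 * (X + 2 * m.+1%:R - 1 - I) * (X + 2 * m.+1%:R - I)) * s m.+1);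
    last by rewrite -[m.+1%:R]natr1; ring.
  rewrite ptailS // /Abar.
  have -> : absz (x%:Z + m.+1%:Z + 1 + i) = (absz (x%:Z + m%:Z + 1 + i)).+1 by lia.
  rewrite factS natrM (@invfactS' (2 * i + 5 - m.+1%:Z) (2 * i + 5 - m%:Z)); last lia.
  rewrite (@invfactS' (x%:Z + 2 * m%:Z - i) (x%:Z + 2 * m%:Z - i + 1)) //.
  rewrite (@invfactS' (x%:Z + 2 * m%:Z - i + 1) (x%:Z + 2 * m.+1%:Z - i)); last lia.
  have -> : ((absz (x%:Z + m%:Z + 1 + i)).+1)%:R = X + m%:R + 2 + I :> rat.
    rewrite /I /X.
    have -> : forall n, n%:R = (n%:Z)%:~R :> rat by [].
    have -> : ((absz (x%:Z + m%:Z + 1 + i)).+1)%:Z = x%:Z + m%:Z + 2 + i by lia.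
    by rewrite !rmorphD.
  rewrite !(rmorphB, rmorphD, rmorphM) /= -/I /a -[m.+1%:R]natr1 -/X /c; ring.
have term m : ptail p m * ((X + I + 2) * (- c + 3 * I + I ^+ 2 - 3 * X - X ^+ 2)
    * pathmxz x i m
  + (60 - 12 * c + 104 * I - 5 * I * c + 52 * I ^+ 2
     + 8 * I ^+ 3 - 10 * X - 4 * X * c + 18 * X * I
     + 8 * X * I ^+ 2 - 22 * X ^+ 2 - 4 * X ^+ 2 * I - 4 * X ^+ 3)
    * pathmxz x (i + 1) m
  + 2 * (2 * I + 5)
    * (2 * (I + 2) * (2 * X + 2 * I + 7) - c) * pathmxz x (i + 2) m)
  = G' m - G m.
  rewrite /G /G' /pathmxz /Abar.
  have -> : absz (x%:Z + m%:Z + 1 + (i + 1)) = (absz (x%:Z + m%:Z + 1 + i)).+1 by lia.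
  have -> : absz (x%:Z + m%:Z + 1 + (i + 2)) = (absz (x%:Z + m%:Z + 1 + i)).+2 by lia.
  set F := absz _; rewrite !factS !natrM.
  have EF : F%:R = X + m%:R + 1 + I :> rat.
    rewrite /I /X.
    have -> : forall n, n%:R = (n%:Z)%:~R :> rat by [].
    have -> : F%:Z = x%:Z + m%:Z + 1 + i by lia.
    by rewrite !rmorphD.
  rewrite -[F.+2%:R]natr1 -[F.+1%:R]natr1 EF.
  set k1 := 2 * i + 5 - m%:Z; set k2 := x%:Z + 2 * m%:Z - i.
  have -> : 2 * (i + 2) + 1 - m%:Z = k1 by rewrite /k1; lia.
  have -> : 2 * (i + 1) + 1 - m%:Z = k1 - 2 by rewrite /k1; lia.
  have -> : 2 * i + 1 - m%:Z = k1 - 4 by rewrite /k1; lia.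
  have -> : x%:Z + 2 * m%:Z - (i + 1) = k2 - 1 by rewrite /k2; lia.
  have -> : x%:Z + 2 * m%:Z - (i + 2) = k2 - 2 by rewrite /k2; lia.
  rewrite (@invfactS' (k1 - 4) (k1 - 3)); last lia.
  rewrite (@invfactS' (k1 - 3) (k1 - 2)); last lia.
  rewrite (@invfactS' (k1 - 2) (k1 - 1)); last lia.
  rewrite (@invfactS' (k1 - 1) k1); last lia.
  rewrite (@invfactS' (k2 - 2) (k2 - 1)); last lia.
  rewrite (@invfactS' (k2 - 1) k2); last lia.
  rewrite !(rmorphB, rmorphD, rmorphM) /= -/I.
  rewrite /b /a /s -[m.+1%:R]natr1 -/X /acoef /ccoef /X. ring.
rewrite -/I -/c Ssum_lin (eq_bigr _ (fun m _ => term m)).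
rewrite sumrB big_nat_recr //= [X in _ - X]big_nat_recl //=.
rewrite (_ : G' p = 0); last by rewrite /G' /a subrr; ring.
rewrite (_ : G 0 = 0); last by rewrite /G /b; ring.
rewrite addr0 add0r; apply/eqP; rewrite subr_eq0; apply/eqP.
by apply: eq_big_nat => m /andP[_ lt_mp]; rewrite GG.
Qed.

Lemma SsumN1 p : Ssum p (-1) = 0.
Proof.
rewrite /Ssum big1 // => m _; rewrite /pathmxz.
by rewrite (_ : 2 * -1 + 1 - m%:Z = Negz m) /= ?mulr0 ?mul0r ?mulr0 //; lia.
Qed.

Lemma Ssum0 p : (0 < p)%N -> Ssum p 0 = 0.
Proof.
have E0 m : pathmxz x 0 m = pathmx x 0 m := pathmxzE x 0 m.
case: p => // p _; rewrite /Ssum.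
rewrite big_nat_recl // big_nat_recl //= big1_seq ?addr0; last first.
  by move=> m _; rewrite E0 /pathmx mulr0.
have c0 : ccoef 0 = 0 by rewrite /ccoef; ring.
have a1 : acoef 1 = 0 by rewrite /acoef; ring.
have A0 : pathmx x 0 0 = X + 1.
  rewrite /pathmx (_ : (0 <= 0.*2.+1)%N = true) //.
  by rewrite (_ : 0.*2.+1 - 0 = 1)%N // bin1 !addn0 natrD.
have A1 : pathmx x 0 1 = 1
  by rewrite /pathmx (_ : (1 <= 0.*2.+1)%N = true) // (_ : 0.*2.+1 - 1 = 0)%N // bin0.
have := @ptailS p.+1 0 isT; rewrite !E0 A0 A1 a1 c0.
move: (ptail _ 0) (ptail _ 1) => t0 t1 H.
apply: (@mulIf _ (ccoef p.+1)); first by rewrite -c0 (inj_eq ccoef_inj).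
rewrite mul0r mulrDl; transitivity (t0 * (X + 1) * ccoef p.+1 +
  t1 * ((0%:R + 1) * (ccoef p.+1 - 0))); first by ring.
by rewrite H; ring.
Qed.

(** The coefficient of [Ssum p (i + 2)] in the recurrence is a non-zero multiple of
    [ccoef (i + 2) - ccoef p]. The zeros at [-1] and [0] therefore propagate, and the argument stops
    precisely at index [p]. *)
Lemma Ssum_eq0 p (i : nat) : (i < p)%N -> Ssum p i = 0.
Proof.
have [n] := ubnP i; elim: n i => // n IH [|[|i]] lt_in lt_ip; first exact: Ssum0.
- have R1 : -1 <= -1 :> int by lia.
  have := Ssum_rec p R1.
  have -> : (-1 + 1 = 0 :> int) by [].
  have -> : (-1 + 2 = 1 :> int) by [].
  rewrite SsumN1 Ssum0 ?(ltn_trans _ lt_ip) //.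
  rewrite mulr0 mulr0 !add0r => /eqP; rewrite mulf_eq0 => /orP[|/eqP//].
  rewrite (_ : 2 * _ * _ = 6 * (ccoef 1 - ccoef p)); last first.
    by rewrite /ccoef rmorphN1; ring.
  rewrite mulf_eq0 /= subr_eq0 (inj_eq ccoef_inj) => /eqP Ep.
  by rewrite -Ep in lt_ip.
have R1 : -1 <= i%:Z by lia.
have := Ssum_rec p R1; rewrite -!PoszD addn1 addn2 (IH i) ?(IH i.+1); try lia.
rewrite mulr0 mulr0 !add0r => /eqP; rewrite mulf_eq0 => /orP[|/eqP//].
  rewrite (_ : 2 * _ * _ = 2 * (2 * i + 5)%N%:R * (ccoef i.+2 - ccoef p)); last first.
    by rewrite /ccoef -[i.+2%:R]natr1 -[i.+1%:R]natr1 natrD natrM; ring.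
  rewrite !mulf_eq0 subr_eq0 (inj_eq ccoef_inj) !pnatr_eq0 addn_eq0 andbF /=.
  by move=> /eqP Ep; rewrite Ep ltnn in lt_ip.
Qed.
End Hypergeometric.

(** * Triangular decomposition and the determinant of two blocks of columns *)

Lemma prod_nat_eq0 (F : nat -> rat) a b l : (a <= l < b)%N -> F l = 0 ->
  \prod_(a <= k < b) F k = 0.
Proof.
move=> lab F0; rewrite (bigD1_seq l) ?iota_uniq ?mem_index_iota //=.
by rewrite F0 mul0r.
Qed.

Lemma prod_shift (F : nat -> rat) q i j :
  \prod_(q + i <= l < q + j) F l = \prod_(i <= l < j) F (q + l)%N.
Proof.
rewrite [(q + i)%N]addnC big_addn addKn.
by apply: eq_bigr => l _; rewrite addnC.
Qed.

Lemma prod_nat_neq0 (F : nat -> rat) a b :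
  (forall l, (a <= l < b)%N -> F l != 0) -> \prod_(a <= k < b) F k != 0.
Proof.
move=> F0; rewrite prodf_seq_neq0; apply/allP => l; rewrite mem_index_iota /=.
exact: F0.
Qed.

(* The telescoping identity behind Krattenthaler's matrix inverse. *)
Lemma telescope_prod (c a : nat -> rat) (mu nu : rat) k :
  (mu - nu) * \sum_(0 <= m < k) (c m - a m)
    * (\prod_(0 <= l < m) (mu - a l) * \prod_(m.+1 <= l < k) (mu - c l))
    * (\prod_(0 <= l < m) (nu - c l) * \prod_(m.+1 <= l < k) (nu - a l))
  = \prod_(0 <= l < k) (mu - c l) * \prod_(0 <= l < k) (nu - a l)
    - \prod_(0 <= l < k) (mu - a l) * \prod_(0 <= l < k) (nu - c l).
Proof.
elim: k => [|k IH]; first by rewrite !big_geq // mulr0 subrr.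
rewrite big_nat_recr //= mulrDr !(@big_geq _ _ _ k.+1 k.+1) //.
rewrite (eq_big_nat _ _ (F2 := fun m => (mu - c k) * (nu - a k) *
  ((c m - a m) * (\prod_(0 <= l < m) (mu - a l) * \prod_(m.+1 <= l < k) (mu - c l))
    * (\prod_(0 <= l < m) (nu - c l) * \prod_(m.+1 <= l < k) (nu - a l))))); last first.
  move=> m /andP[_ lt_mk]; rewrite !(@big_nat_recr _ _ _ k m.+1) //=.
  move: (\prod_(0 <= l < m) _) (\prod_(m.+1 <= l < k) _) (\prod_(0 <= l < m) _)
   (\prod_(m.+1 <= l < k) _) => *; ring.
rewrite -mulr_sumr mulrCA IH !(@big_nat_recr _ _ _ k 0) //=.
move: (\prod_(0 <= l < k) _) (\prod_(0 <= l < k) _) (\prod_(0 <= l < k) _)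
   (\prod_(0 <= l < k) _) => *; ring.
Qed.

Section Decomposition.
Variable x : nat.
Let X : rat := x%:R.
Notation c := (ccoef x).
Notation a := (acoef x).

Definition gcoef (m : nat) : rat :=
  (-1) ^+ m * (2 * X + 3 * m%:R + 2) * (m.+1)`!%:R / ((x + m)`!)%:R.

Lemma gcoef_neq0 m : gcoef m != 0.
Proof.
rewrite /gcoef !mulf_neq0 ?signr_eq0 ?invr_eq0 ?fact_neq0 //.
by rewrite /X -!natrM -!natrD pnatr_eq0; lia.
Qed.

Variable N : nat.

(** The second product is extended to an auxiliary bound [N] so that all [phi m] are polynomials of
    the same degree [N] in [mu]. *)
Definition phi (m : nat) (mu : rat) : rat :=
  \prod_(0 <= l < m) (mu - a l) * \prod_(m.+1 <= l < N.+1) (mu - c l).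

Lemma phi_eq0 m r : (m < r <= N)%N -> phi m (c r) = 0.
Proof.
move=> mr; rewrite /phi [X in _ * X](@prod_nat_eq0 _ _ _ r) ?mulr0 ?subrr //.
Qed.

Lemma phi_eq0_gt m r : (r.*2.+1 < m)%N -> phi m (c r) = 0.
Proof.
move=> rm; rewrite /phi [X in X * _](@prod_nat_eq0 _ _ _ r.*2.+1) ?mul0r //.
by rewrite ccoef_acoef addn1 mul2n subrr.
Qed.

Lemma phi_neq0 m r : (r <= m <= r.*2.+1)%N -> phi m (c r) != 0.
Proof.
move=> rm; rewrite mulf_neq0 //; apply: prod_nat_neq0 => l lm.
  by rewrite ccoef_sub_acoef_neq0 //; lia.
by rewrite subr_eq0 (inj_eq (@ccoef_inj x)); lia.
Qed.

Lemma phi_wprod p r : (p <= N)%N -> (r <= N)%N -> r != p ->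
  \sum_(0 <= m < p.+1) (c m - a m) * phi m (c r) * wprod x p m = 0.
Proof.
move=> le_pN le_rN ne_rp; have [lt_pr | le_rp] := ltnP p r.
  by rewrite big1_seq // => m; rewrite mem_index_iota /= => mp;
    rewrite phi_eq0 ?mulr0 ?mul0r //; lia.
have := telescope_prod c a (c r) (c p) p.+1.
have -> : \prod_(0 <= l < p.+1) (c r - c l) = 0.
  by apply: (@prod_nat_eq0 _ _ _ r); rewrite ?subrr.
have -> : \prod_(0 <= l < p.+1) (c p - c l) = 0.
  by apply: (@prod_nat_eq0 _ _ _ p); rewrite ?subrr ?leqnn.
rewrite mulr0 mul0r subr0 => /eqP; rewrite mulf_eq0 subr_eq0 (inj_eq (@ccoef_inj x)).
rewrite (negPf ne_rp) /= => /eqP H.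
(* The telescoping identity has length [p.+1]; this factor completes its products to those of
   [phi]. *)
have := congr1 ( *%R (\prod_(p.+1 <= l < N.+1) (c r - c l))) H.
rewrite mulr0 mulr_sumr; apply: etrans; apply: eq_big_nat => m mp.
rewrite /phi /wprod (big_cat_nat (n := p.+1) (m := m.+1)) //=.
move: (\prod_(0 <= l < m) _) (\prod_(m.+1 <= l < _) _) (\prod_(p.+1 <= l < _) _)
   (\prod_(0 <= l < _) _) (\prod_(m.+1 <= l < _) _) => *; ring.
Qed.

Lemma phi_wprod_diag p : (p <= N)%N ->
  \sum_(0 <= m < p.+1) (c m - a m) * phi m (c p) * wprod x p m != 0.
Proof.
move=> le_pN; rewrite big_nat_recr //= big1_seq ?add0r; last first.
  by move=> m; rewrite mem_index_iota /= => mp; rewrite phi_eq0 ?mulr0 ?mul0r //; lia.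
apply: mulf_neq0; first apply: mulf_neq0.
- by rewrite ccoef_sub_acoef_neq0; lia.
- by rewrite phi_neq0; lia.
apply: mulf_neq0; last by rewrite big_geq // oner_neq0.
by apply: prod_nat_neq0 => l lm; rewrite subr_eq0 (inj_eq (@ccoef_inj x)); lia.
Qed.

Lemma pathmx_wprod p i : (i < p)%N ->
  \sum_(0 <= m < p.+1) (c m - a m) * (pathmx x i m / gcoef m) * wprod x p m = 0.
Proof.
move=> lt_ip; apply: etrans (Ssum_eq0 x lt_ip); apply: eq_bigr => m _.
rewrite pathmxzE /ptail /gcoef ccoef_sub_acoef factS natrM -[m.+1%:R]natr1 -/X.
have m1 : m%:R + 1 != 0 :> rat by rewrite natr1 pnatr_eq0.
have X0 : 2 * X + 3 * m%:R + 2 != 0 :> rat.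
  by rewrite /X -!natrM -!natrD pnatr_eq0; lia.
have s0 : (-1) ^+ m != 0 :> rat by rewrite signr_eq0.
have f0 := fact_neq0 m; have f1 := fact_neq0 (x + m).
rewrite -[RHS](mulrK (x := (-1) ^+ m)) ?unitfE //.
have := sqrr_sign rat m; move: ((-1) ^+ m) s0 => s s0 ss.
move: (m`!%:R) ((x + m)`!%:R) f0 f1 (pathmx _ _ _) (wprod _ _ _) => u v u0 v0 A w.
rewrite (_ : s * v / u * w * A * s = s ^+ 2 * (v / u * w * A)); last by ring.
by rewrite ss; field; rewrite u0 v0 s0 m1 X0.
Qed.

Lemma wprod_eq0 p m : (p < m)%N -> wprod x p m = 0.
Proof.
by move=> lt_pm; rewrite /wprod (@prod_nat_eq0 _ _ _ p) ?mul0r ?subrr.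
Qed.

Lemma sum_wprod (F : nat -> rat) p : (p <= N)%N ->
  \sum_(m < N.+1) (c m - a m) * F m * wprod x p m =
  \sum_(0 <= m < p.+1) (c m - a m) * F m * wprod x p m.
Proof.
move=> le_pN; rewrite -(big_mkord xpredT (fun m => (c m - a m) * F m * wprod x p m)).
rewrite (big_cat_nat (n := p.+1)) //= [X in _ + X]big1_seq ?addr0 // => m.
by rewrite mem_index_iota => /andP[_ /andP[lt_pm _]]; rewrite wprod_eq0 ?mulr0.
Qed.

(** [L] is the matrix [pathmx] with rescaled columns times the inverse of [phi]. Its entries above
    the diagonal are multiples of the sums in [pathmx_wprod], hence zero. *)
Lemma pathmx_LU : exists L : nat -> nat -> rat, forall i m, (i <= N)%N -> (m <= N)%N ->
  pathmx x i m = gcoef m * \sum_(0 <= p < i.+1) L i p * phi m (c p).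
Proof.
pose Phi : 'M[rat]_N.+1 := \matrix_(r, m) phi m (c r).
pose W : 'M[rat]_N.+1 := \matrix_(m, p) ((c m - a m) * wprod x p m).
pose d (p : nat) := \sum_(m < N.+1) (c m - a m) * phi m (c p) * wprod x p m.
have d0 (p : 'I_N.+1) : d p != 0.
  by rewrite /d (sum_wprod (phi^~ _)) ?phi_wprod_diag // -ltnS.
have PW : Phi *m W = diag_mx (\row_p d p).
  apply/matrixP => r p; rewrite !mxE; have [-> | ne_rp] := eqVneq r p.
    by rewrite mulr1n; apply: eq_bigr => m _; rewrite !mxE mulrCA mulrA.
  have [lpN lrN] := (ltn_ord p, ltn_ord r); rewrite ltnS in lpN; rewrite ltnS in lrN.
  rewrite mulr0n; apply: etrans (phi_wprod lpN lrN ne_rp).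
  rewrite -(sum_wprod (phi^~ _)) //.
  by apply: eq_bigr => m _; rewrite !mxE mulrCA mulrA.
pose D' : 'M[rat]_N.+1 := diag_mx (\row_p (d p)^-1).
have WP : W *m D' *m Phi = 1%:M.
  apply: mulmx1C; rewrite mulmxA PW; apply/matrixP => r p.
  rewrite mul_diag_mx !mxE.
  by have [->|] := eqVneq r p; rewrite ?mulr1n ?mulr0n ?mulr0 // divff.
pose A' : 'M[rat]_N.+1 := \matrix_(i, m) (pathmx x i m / gcoef m).
pose L i p := (A' *m W) (inord i) (inord p) / d p.
exists L => i m le_iN le_mN.
have : A' = A' *m W *m D' *m Phi by rewrite -!mulmxA (mulmxA W) WP mulmx1.
move/matrixP/(_ (inord i) (inord m)); rewrite [in LHS]mxE !inordK ?ltnS // => E.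
rewrite -[LHS](mulfVK (gcoef_neq0 m)) mulrC; congr (_ * _); rewrite E.
rewrite mxE; transitivity (\sum_(p < N.+1) L i p * phi m (c p)).
  apply: eq_bigr => p _; rewrite mul_mx_diag [in LHS]mxE /L inord_val.
  by rewrite [(\row__ _) _ _]mxE [Phi _ _]mxE inordK ?ltnS.
rewrite -(big_mkord xpredT (fun p => L i p * phi m (c p))).
rewrite (big_cat_nat (n := i.+1)) //= [X in _ + X]big1_seq ?addr0 // => p.
rewrite mem_index_iota => /andP[_ /andP[lt_ip le_pN]].
rewrite /L [(A' *m W) _ _]mxE; set t := \sum_(_ | _) _; suff -> : t = 0 by rewrite !mul0r.
apply: etrans (pathmx_wprod lt_ip).
rewrite -(sum_wprod (fun m => pathmx x i m / gcoef m)) //.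
by apply: eq_bigr => m' _; rewrite !mxE !inordK ?ltnS // mulrCA mulrA.
Qed.
End Decomposition.

(** The differences are oriented as in the diagonal entries of the triangular case [X = C] of
    [det_krattenthaler], so that no sign appears there. *)
Definition vdm (X : nat -> rat) (z : nat) : rat :=
  \prod_(0 <= j < z) \prod_(0 <= i < j) (X i - X j).

Lemma det_Vandermonde_nat (X : nat -> rat) z :
  \det (Vandermonde z (\row_(j < z) X j)) =
  \prod_(0 <= j < z) \prod_(0 <= i < j) (X j - X i).
Proof.
rewrite det_Vandermonde (exchange_big_dep xpredT) //= big_mkord; apply: eq_bigr => j _.
rewrite big_mkord (big_ord_widen z (fun i => X j - X i) (ltnW (ltn_ord j))).
by apply: eq_bigr => i _; rewrite !mxE.
Qed.

Lemma vdm_sign (X : nat -> rat) z :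
  vdm X z = \prod_(0 <= j < z) (-1) ^+ j
    * \prod_(0 <= j < z) \prod_(0 <= i < j) (X j - X i).
Proof.
rewrite /vdm -big_split; apply: eq_bigr => j _ /=.
have -> : (-1) ^+ j = \prod_(0 <= i < j) (-1) :> rat by rewrite prodr_const_nat subn0.
rewrite -big_split; apply: eq_bigr => i _ /=.
by rewrite mulN1r opprB.
Qed.

(* The matrix is a Vandermonde matrix in [X] times a matrix of coefficients
   that does not depend on [X]; the determinant of the latter is read off at
   [X = C], where the product is triangular. *)
Lemma det_krattenthaler z (X a C : nat -> rat) : injective C ->
  \det (\matrix_(r < z, s < z) (\prod_(0 <= l < s) (X r - a l)
                               * \prod_(s.+1 <= l < z) (X r - C l)))
  = vdm X z * \prod_(0 <= s < z) \prod_(0 <= l < s) (C s - a l).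
Proof.
move=> injC.
pose pol (s : nat) : {poly rat} := \prod_(0 <= l < s) ('X - (a l)%:P)
                                 * \prod_(s.+1 <= l < z) ('X - (C l)%:P).
have size_pol (s : 'I_z) : (size (pol s) <= z)%N.
  rewrite (leq_trans (size_polyMleq _ _)) // !size_prod_XsubC !size_iota.
  by have := ltn_ord s; lia.
pose B : 'M[rat]_z := \matrix_(k, s) (pol s)`_k.
have matE (Y : nat -> rat) : \matrix_(r < z, s < z) (\prod_(0 <= l < s) (Y r - a l)
    * \prod_(s.+1 <= l < z) (Y r - C l)) = (Vandermonde z (\row_(j < z) Y j))^T *m B.
  apply/matrixP => r s; rewrite !mxE.
  transitivity (pol s).[Y r].
    rewrite hornerM !horner_prod.
    by congr (_ * _); apply: eq_bigr => l _; rewrite hornerXsubC.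
  rewrite (horner_coef_wide _ (size_pol s)); apply: eq_bigr => k _.
  by rewrite !mxE mulrC.
have detE (Y : nat -> rat) : \det (\matrix_(r < z, s < z) (\prod_(0 <= l < s) (Y r - a l)
    * \prod_(s.+1 <= l < z) (Y r - C l))) =
    \prod_(0 <= j < z) \prod_(0 <= i < j) (Y j - Y i) * \det B.
  by rewrite matE det_mulmx det_tr det_Vandermonde_nat.
have C0 : \prod_(0 <= j < z) \prod_(0 <= i < j) (C j - C i) != 0.
  apply: prod_nat_neq0 => j _; apply: prod_nat_neq0 => i /andP[_ lt_ij].
  rewrite subr_eq0 (inj_eq injC); lia.
have := detE C; rewrite -det_tr det_trig; last first.
  apply/is_trig_mxP => i j lt_ij; rewrite !mxE.
  by rewrite [X in _ * X](@prod_nat_eq0 _ _ _ j) ?mulr0 ?subrr // lt_ij ltn_ord.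
rewrite (_ : \prod_(i < z) _ = vdm C z * \prod_(0 <= s < z) \prod_(0 <= l < s) (C s - a l)).
  rewrite vdm_sign detE => E; apply: (mulfI C0).
  rewrite vdm_sign mulrCA -E; move: (\det B) => *; ring.
rewrite /vdm mulrC.
transitivity (\prod_(0 <= i < z) (\prod_(0 <= l < i) (C i - a l) * \prod_(i.+1 <= l < z) (C i - C l))).
  by rewrite big_mkord; apply: eq_bigr => i _; rewrite !mxE.
rewrite big_split /=; congr (_ * _).
elim: z {pol size_pol B matE detE C0 } => [|z IH]; first by rewrite !big_geq.
rewrite big_nat_recr //= [in RHS]big_nat_recr //= -IH.
rewrite [X in _ * X = _]big_geq // mulr1 -big_split; apply: eq_big_nat => i /andP[_ lt_iz].
by rewrite big_nat_recr.
Qed.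

Definition teeth (P q t : nat) : nat := if (t < P)%N then t else (q + (t - P))%N.

Section Blocks.
Variables (x P q z N : nat).
Hypotheses (le_Pq : (P <= q)%N) (le_qN : (q + z <= N.+1)%N)
           (le_nN : ((P + z).*2 <= N.+1)%N).
Notation c := (ccoef x).
Notation a := (acoef x).
Notation g := (gcoef x).
Notation phi := (phi x N).

(** Row [P + r] has a factor common to all columns of the block; what is left is the matrix of
    [det_krattenthaler] with [a] and [c] shifted by [q]. *)
Lemma det_phi_block :
  \det (\matrix_(r < z, s < z) phi (q + s) (c (P + r))) =
  \prod_(0 <= r < z) (\prod_(0 <= l < q) (c (P + r) - a l)
                      * \prod_(q + z <= l < N.+1) (c (P + r) - c l))
  * (vdm (fun r => c (P + r)) z
     * \prod_(0 <= s < z) \prod_(0 <= l < s) (c (q + s) - a (q + l))).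
Proof.
have injC : injective (fun s => c (q + s)) by move=> s t /ccoef_inj /addnI.
rewrite -(det_krattenthaler _ _ _ injC) big_mkord.
have -> : \prod_(r < z) (\prod_(0 <= l < q) (c (P + r) - a l)
    * \prod_(q + z <= l < N.+1) (c (P + r) - c l)) = \det (diag_mx
  (\row_(r < z) (\prod_(0 <= l < q) (c (P + r) - a l)
                      * \prod_(q + z <= l < N.+1) (c (P + r) - c l)))).
  by rewrite det_diag; apply: eq_bigr => r _; rewrite mxE.
rewrite -det_mulmx; congr (\det _); apply/matrixP => r s.
rewrite mul_diag_mx !mxE /phi.
rewrite (big_cat_nat (n := q)) ?leq_addr //= (big_cat_nat (m := (q + s).+1) (n := (q + z)%N)) //=; last first.
  by rewrite ltn_add2l.
rewrite -[X in \prod_(X <= i < q + s) _](addn0 q) prod_shift -addnS prod_shift.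
move: (\prod_(0 <= i < q) _) (\prod_(0 <= i < s) _) (\prod_(s.+1 <= i < z) _) => *; ring.
Qed.

Lemma det_phi_teeth :
  \det (\matrix_(p < P + z, t < P + z) phi (teeth P q t) (c p)) =
  \prod_(0 <= p < P) phi p (c p)
  * \det (\matrix_(r < z, s < z) phi (q + s) (c (P + r))).
Proof.
rewrite -[X in \det X]submxK.
set A := \matrix_(_, _) _.
have -> : dlsubmx A = 0.
  apply/matrixP => r s; rewrite !mxE /teeth /= ltn_ord phi_eq0 //.
  have := ltn_ord r; have := ltn_ord s; lia.
rewrite det_ublock -(det_tr (ulsubmx A)) det_trig; last first.
  apply/is_trig_mxP => i j lt_ij; rewrite !mxE /teeth /= ltn_ord phi_eq0 //.
  have := ltn_ord i; have := ltn_ord j; lia.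
congr (_ * _).
  by rewrite big_mkord; apply: eq_bigr => i _; rewrite !mxE /teeth /= ltn_ord.
congr (\det _); apply/matrixP => r s; rewrite !mxE /teeth /=.
by rewrite ltnNge leq_addr addKn.
Qed.

Lemma det_pathmx_teeth :
  \det (\matrix_(i < P + z, t < P + z) pathmx x i (teeth P q t)) =
  (\prod_(0 <= i < P + z) (g i.*2.+1 * phi i.*2.+1 (c i)))^-1
  * (\prod_(0 <= p < P) (g p * phi p (c p)) * \prod_(0 <= s < z) g (q + s))
  * \det (\matrix_(r < z, s < z) phi (q + s) (c (P + r))).
Proof.
have [L HL] := pathmx_LU x N.
pose n := (P + z)%N.
pose Lm : 'M[rat]_n := \matrix_(i, p) (if (p <= i)%N then L i p else 0).
have teeth_le (t : 'I_n) : (teeth P q t <= N)%N.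
  by rewrite /teeth; case: ifP; have := ltn_ord t; rewrite /n; lia.
(* In column [2i + 1] row [i] of [pathmx] has the entry 1, and [phi] vanishes at every [c p] with
   [p < i], so the sum for [pathmx] reduces to its term [p = i]. *)
have Ldiag (i : nat) : (i < n)%N -> L i i = (g i.*2.+1 * phi i.*2.+1 (c i))^-1.
  rewrite /n => lt_in; have nz : g i.*2.+1 * phi i.*2.+1 (c i) != 0.
    by rewrite mulf_neq0 ?gcoef_neq0 ?phi_neq0 //; lia.
  have [le_iN le_mN] : (i <= N)%N /\ (i.*2.+1 <= N)%N by split; lia.
  have := HL i i.*2.+1 le_iN le_mN; rewrite /pathmx leqnn subnn bin0.
  rewrite big_nat_recr //= big1_seq ?add0r => [H|p]; last first.
    by rewrite mem_index_iota /= => lt_pi; rewrite phi_eq0_gt ?mulr0 //; lia.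
  by apply: (mulIf nz); rewrite mulVf // mulrCA -H.
have -> : \matrix_(i < P + z, t < P + z) pathmx x i (teeth P q t) =
  Lm *m (\matrix_(p, t) phi (teeth P q t) (c p))
     *m diag_mx (\row_t g (teeth P q t)).
  apply/matrixP => i t; rewrite mul_mx_diag !mxE HL ?teeth_le //; last first.
    by have := ltn_ord i; lia.
  rewrite mulrC; congr (_ * _).
  rewrite (big_nat_widen 0 i.+1 n) // big_mkord.
  rewrite big_mkcond; apply: eq_bigr => p _; rewrite !mxE /= ltnS.
  by case: ifP; rewrite ?mul0r.
rewrite !det_mulmx det_diag det_phi_teeth.
rewrite det_trig; last first.
  by apply/is_trig_mxP => i j lt_ij; rewrite mxE leqNgt lt_ij.
have -> : \prod_(i < n) Lm i i = (\prod_(0 <= i < P + z) (g i.*2.+1 * phi i.*2.+1 (c i)))^-1.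
  rewrite -prodfV big_mkord; apply: eq_bigr => i _; rewrite mxE leqnn Ldiag //.
have -> : \prod_(t < n) (\row_t0 g (teeth P q t0)) 0 t =
  \prod_(0 <= p < P) g p * \prod_(0 <= s < z) g (q + s).
  rewrite big_split_ord /= !big_mkord; congr (_ * _); apply: eq_bigr => i _.
    by rewrite mxE /teeth /= ltn_ord.
  by rewrite mxE /teeth /= ltnNge leq_addr addKn.
rewrite [X in _ = _ * (X * _) * _]big_split /=.
move: (\det _) (\prod_(0 <= i < P + z) _)^-1 => d1 d2.
move: (\prod_(0 <= i < P) _) (\prod_(0 <= i < P) _) (\prod_(0 <= i < z) _) => *; ring.
Qed.
End Blocks.

Definition teethdet (x P q z : nat) : rat :=
  \det (\matrix_(i < P + z, t < P + z) pathmx x i (teeth P q t)).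

(** The effect of one more row [r] and column [m]. The new row contributes its common factor divided
    by [phi] at column [2r + 1]; the old rows lose the factors [c (P + t) - c m], the Vandermonde
    product gains [c (P + t) - c r], and the last product is the new diagonal entry. The bound [N]
    has cancelled. *)
Definition teethratio (x P q z : nat) : rat :=
  let r := (P + z)%N in let m := (q + z)%N in
  gcoef x m / gcoef x r.*2.+1
  * \prod_(m.+1 <= l < r.*2.+2) (ccoef x r - ccoef x l)
  / \prod_(q <= l < r.*2.+1) (ccoef x r - acoef x l)
  * (\prod_(0 <= t < z) (ccoef x (P + t) - ccoef x r)
     / \prod_(0 <= t < z) (ccoef x (P + t) - ccoef x m))
  * \prod_(0 <= l < z) (ccoef x m - acoef x (q + l)).

Lemma teethdetS x P q z : (P <= q <= P.*2.+1)%N ->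
  teethdet x P q z.+1 = teethdet x P q z * teethratio x P q z.
Proof.
move=> /andP[le_Pq le_q2P]; pose N := (P + z + q + z + P + 10)%N.
rewrite /teethdet /teethratio !(@det_pathmx_teeth _ _ _ _ N) ?det_phi_block; try by rewrite /N; lia.
set r := (P + z)%N; set m := (q + z)%N.
rewrite addnS -/r.
rewrite (@big_nat_recr _ _ _ r 0) //= (@big_nat_recr _ _ _ z 0 (fun s => gcoef x (q + s))) //=.
rewrite (@big_nat_recr _ _ _ z 0 (fun r => _ * _)) //= -/r -/m.
rewrite (@big_nat_recr _ _ _ z 0 (fun s => \prod_(0 <= l < s) _)) //= -/m.
rewrite /vdm (@big_nat_recr _ _ _ z 0 (fun j => \prod_(0 <= i < j) _)) //= -/r.
rewrite addnS -/m.
have -> : \prod_(0 <= r0 < z)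
     (\prod_(0 <= l < q) (ccoef x (P + r0) - acoef x l) *
      \prod_(m <= l < N.+1) (ccoef x (P + r0) - ccoef x l)) =
   \prod_(0 <= t < z) (ccoef x (P + t) - ccoef x m) *
   \prod_(0 <= r0 < z)
     (\prod_(0 <= l < q) (ccoef x (P + r0) - acoef x l) *
      \prod_(m.+1 <= l < N.+1) (ccoef x (P + r0) - ccoef x l)).
  rewrite -big_split; apply: eq_bigr => t _ /=.
  by rewrite (@big_ltn _ _ _ m) ?mulrA; [ring | rewrite /N /m; lia].
have d0 : \prod_(0 <= t < z) (ccoef x (P + t) - ccoef x m) != 0.
  apply: prod_nat_neq0 => t lt_tz; rewrite subr_eq0 (inj_eq (@ccoef_inj x)) /m; lia.
rewrite /phi (big_cat_nat (m := 0) (n := q) (p := r.*2.+1)) //=; last by rewrite /r; lia.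
rewrite (big_cat_nat (m := m.+1) (n := r.*2.+2) (p := N.+1) (F := fun l => ccoef x r - ccoef x l)) //=;
  try by rewrite /N /r /m; lia.
have a0 : \prod_(0 <= l < q) (ccoef x r - acoef x l) != 0.
  apply: prod_nat_neq0 => l lq; apply: ccoef_sub_acoef_neq0; rewrite /r; lia.
have a1 : \prod_(q <= l < r.*2.+1) (ccoef x r - acoef x l) != 0.
  apply: prod_nat_neq0 => l lq; apply: ccoef_sub_acoef_neq0; rewrite /r; lia.
have a2 : \prod_(r.*2.+2 <= l < N.+1) (ccoef x r - ccoef x l) != 0.
  by apply: prod_nat_neq0 => l lq; rewrite subr_eq0 (inj_eq (@ccoef_inj x)); lia.
have a3 := gcoef_neq0 x r.*2.+1.
have a4 : \prod_(0 <= i < r) (gcoef x i.*2.+1 *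
     (\prod_(0 <= l < i.*2.+1) (ccoef x i - acoef x l) *
       \prod_(i.*2.+2 <= l < N.+1) (ccoef x i - ccoef x l))) != 0.
  apply: prod_nat_neq0 => i ir; rewrite mulf_neq0 ?gcoef_neq0 //.
  by apply: (@phi_neq0 x N); lia.
move: d0 a0 a1 a2 a3 a4.
move: (\prod_(0 <= i < r) _) (\prod_(0 <= p < P) _).
do 7! [move: (\prod_(0 <= i < z) _)].
move: (\prod_(0 <= i < q) _) (\prod_(q <= i < r.*2.+1) _).
move: (\prod_(r.*2.+2 <= l < N.+1) _) (\prod_(m.+1 <= l < r.*2.+2) _).
move: (gcoef x r.*2.+1) (gcoef x m).
intros; field; do ?[apply/andP; split]; done.
Qed.

(** * Comparison with the product formula *)

Definition natfact (n : nat) : rat := (n`!)%:R.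

(** The double factorial [(2n - 1)!!]. *)
Definition oddfact (n : nat) : rat := \prod_(0 <= l < n) (2 * l%:R + 1).

Lemma natfact_neq0 n : natfact n != 0. Proof. exact: fact_neq0. Qed.

Lemma natfactS n : natfact n.+1 = (n%:R + 1) * natfact n.
Proof. by rewrite /natfact factS natrM -natr1. Qed.

Lemma oddfactS n : oddfact n.+1 = (2 * n%:R + 1) * oddfact n.
Proof. by rewrite /oddfact big_nat_recr //= mulrC. Qed.

Lemma oddfact_neq0 n : oddfact n != 0.
Proof. by apply: prod_nat_neq0 => l _; rewrite -natrM natr1 pnatr_eq0. Qed.

Lemma natfact_double n : natfact (2 * n) = 2 ^+ n * natfact n * oddfact n.
Proof.
elim: n => [|n IH]; first by rewrite /oddfact big_geq // /natfact fact0 expr0 !mulr1.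
rewrite mulnS !natfactS IH oddfactS exprS -[(2 * n).+1%:R]natr1 natrM; ring.
Qed.

Lemma natfact_doubleS n : natfact (2 * n).+1 = 2 ^+ n * natfact n * oddfact n.+1.
Proof. by rewrite natfactS natfact_double oddfactS natrM; ring. Qed.

Section Factorials.
Variable x : nat.
Let X : rat := x%:R.
Notation c := (ccoef x).
Notation a := (acoef x).

(** By [ccoef_sub] a factor is [2(r - l)] times the odd number [2(x + r + l + 1) + 1], whence one
    quotient of factorials and one of double factorials. The offset [d] takes the place of a
    subtraction. *)
Lemma prod_ccoef_right r d n :
  \prod_(r + d.+1 <= l < r + d.+1 + n) (c r - c l) =
  (- 1) ^+ n * 2 ^+ n * (natfact (d + n) / natfact d)
  * (oddfact (x + 2 * r + d + 2 + n) / oddfact (x + 2 * r + d + 2)).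
Proof.
elim: n => [|n IH].
  by rewrite !addn0 big_geq // !expr0 !divff ?natfact_neq0 ?oddfact_neq0 ?mulr1.
rewrite !(addnS _ n) big_nat_recr ?leq_addr //= IH ccoef_sub natfactS oddfactS !exprS.
rewrite !natrD -[d.+1%:R]natr1 -/X.
have := natfact_neq0 d; have := oddfact_neq0 (x + 2 * r + d + 2).
move: (natfact _) (natfact _) (oddfact _) (oddfact _) => *.
by field; apply/andP.
Qed.

Lemma prod_ccoef_acoef r q n e : (2 * r + 1 = q + n + e)%N ->
  \prod_(q <= l < q + n) (c r - a l) = (natfact (n + e) / natfact e)
   * (natfact (2 * x + 2 * r + q + 1 + n) / natfact (2 * x + 2 * r + q + 1)).
Proof.
elim: n e => [|n IH] e E.
  by rewrite !addn0 big_geq // !divff ?natfact_neq0 ?mulr1.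
rewrite addnS big_nat_recr ?leq_addr //= (IH e.+1); last lia.
rewrite ccoef_sub_acoef !(addnS _ n) addSnnS !natfactS.
have -> : 2 * r%:R + 1 - (q + n)%:R = e%:R + 1 :> rat.
  have -> : 2 * r%:R + 1 = (q + n.+1 + e)%:R :> rat by rewrite -E natrD natrM.
  by rewrite !natrD -[n.+1%:R]natr1; ring.
rewrite !natrD -/X.
have := natfact_neq0 e; have := natfact_neq0 (2 * x + 2 * r + q + 1).
have e0 : e%:R + 1 != 0 :> rat by rewrite natr1 pnatr_eq0.
move: (natfact _) (natfact _) (natfact _) (natfact _) => *.
by field; do ?[apply/andP; split].
Qed.

Lemma prod_ccoef_left P n e :
  \prod_(0 <= t < n) (c (P + t) - c (P + n + e)) =
  (- 1) ^+ n * 2 ^+ n * (natfact (n + e) / natfact e)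
  * (oddfact (x + 2 * P + 2 * n + e + 1) / oddfact (x + 2 * P + n + e + 1)).
Proof.
elim: n e => [|n IH] e.
  rewrite big_geq // !expr0 add0n muln0 !addn0.
  by rewrite !divff ?oddfact_neq0 ?natfact_neq0 ?mulr1.
rewrite big_nat_recr //= (_ : P + n.+1 + e = P + n + e.+1)%N ?IH; last lia.
rewrite ccoef_sub !exprS.
rewrite (_ : n + e.+1 = n.+1 + e)%N; last lia.
rewrite (_ : x + 2 * P + 2 * n.+1 + e + 1 = (x + 2 * P + 2 * n + e.+1 + 1).+1)%N; last lia.
rewrite (_ : x + 2 * P + n.+1 + e + 1 = x + 2 * P + n + e.+1 + 1)%N; last lia.
rewrite oddfactS natfactS !natrD -[e.+1%:R]natr1 -/X.
have := natfact_neq0 e; have := oddfact_neq0 (x + 2 * P + n + e.+1 + 1).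
have e0 : e%:R + 1 != 0 :> rat by rewrite natr1 pnatr_eq0.
move: (natfact _) (natfact _) (oddfact _) (oddfact _) => *.
by field; do ?[apply/andP; split].
Qed.

(** Here [d] is the parameter [a] of the region: [P = y + a - 1] and [q = P + a]. *)
Lemma teethratioE P y z d : (y + d = P.+1)%N ->
  teethratio x P (P + d) z =
  2 ^+ (y + z) / 2 ^+ (x + 2 * P + 2 * z + 1)
  * (natfact (2 * x + 3 * P + 3 * z + 3 * d + 2) * natfact (P + z + 1)
     * oddfact (x + 3 * P + 3 * z + 2) * natfact (2 * x + 3 * P + 2 * z + d + 1)
     * natfact z * natfact (P + 1 + 2 * z + d) * oddfact (x + 2 * P + z + d + 1))
  / (natfact (x + P + z + d) * natfact (2 * P + 2 * z + 2)
     * oddfact (x + 2 * P + 2 * z + d + 2) * oddfact (x + 2 * P + 2 * z + d + 1)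
     * natfact (y + 2 * z) * natfact (d + z) * oddfact (x + 2 * P + z + 1)
     * natfact (2 * x + 3 * P + 2 * z + 3 * d + 1)).
Proof.
move=> E; rewrite /teethratio.
have -> : \prod_((P + d + z).+1 <= l < (P + z).*2.+2) (c (P + z) - c l) =
  (- 1) ^+ (y + z) * 2 ^+ (y + z) * (natfact (P + 1 + z) / natfact d)
  * (oddfact (x + 3 * P + 3 * z + 3) / oddfact (x + 2 * P + 2 * z + d + 2)).
  have := prod_ccoef_right (P + z) d (y + z).
  rewrite (_ : P + z + d.+1 = (P + d + z).+1)%N; last lia.
  rewrite (_ : (P + d + z).+1 + (y + z) = (P + z).*2.+2)%N; last lia.
  rewrite (_ : d + (y + z) = P + 1 + z)%N; last lia.
  rewrite (_ : x + 2 * (P + z) + d + 2 + (y + z) = x + 3 * P + 3 * z + 3)%N; last lia.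
  by rewrite (_ : x + 2 * (P + z) + d + 2 = x + 2 * P + 2 * z + d + 2)%N //; lia.
have -> : \prod_(P + d <= l < (P + z).*2.+1) (c (P + z) - a l) =
  natfact (y + 2 * z) * (natfact (2 * x + 4 * P + 4 * z + 2)
  / natfact (2 * x + 3 * P + 2 * z + d + 1)).
  have := @prod_ccoef_acoef (P + z) (P + d) (y + 2 * z) 0.
  rewrite addn0 (_ : P + d + (y + 2 * z) = (P + z).*2.+1)%N; last lia.
  rewrite (_ : 2 * x + 2 * (P + z) + (P + d) + 1 + (y + 2 * z) = 2 * x + 4 * P + 4 * z + 2)%N; last lia.
  rewrite (_ : 2 * x + 2 * (P + z) + (P + d) + 1 = 2 * x + 3 * P + 2 * z + d + 1)%N; last lia.
  by rewrite /(natfact 0) fact0 divr1 addn0 => -> //; lia.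
have := prod_ccoef_left P z 0; rewrite addn0 => ->.
have := prod_ccoef_left P z d; rewrite (_ : P + z + d = P + d + z)%N => [->|]; last lia.
have -> : \prod_(0 <= l < z) (c (P + d + z) - a (P + d + l)) =
  natfact (P + d + 2 * z + 1) / natfact (P + d + z + 1)
  * (natfact (2 * x + 3 * P + 3 * z + 3 * d + 1)
  / natfact (2 * x + 3 * P + 2 * z + 3 * d + 1)).
  have := @prod_ccoef_acoef (P + d + z) (P + d) z (P + d + z + 1).
  rewrite (_ : z + (P + d + z + 1) = P + d + 2 * z + 1)%N; last lia.
  rewrite (_ : 2 * x + 2 * (P + d + z) + (P + d) + 1 + z = 2 * x + 3 * P + 3 * z + 3 * d + 1)%N; last lia.
  rewrite (_ : 2 * x + 2 * (P + d + z) + (P + d) + 1 = 2 * x + 3 * P + 2 * z + 3 * d + 1)%N; last lia.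
  move=> <-; last lia.
  by rewrite -[X in _ = \prod_(X <= _ < _) _]addn0 prod_shift.
rewrite /gcoef -!/(natfact _) -/X.
set n := (x + 2 * P + 2 * z + 1)%N.
have -> : (x + (P + z).*2.+1 = n)%N by rewrite /n; lia.
have -> : (2 * x + 4 * P + 4 * z + 2 = 2 * n)%N by rewrite /n; lia.
have -> : (x + 2 * P + 2 * z + 0 + 1 = n)%N by rewrite /n; lia.
have -> : (x + (P + d + z) = x + P + z + d)%N by lia.
have -> : ((P + z).*2.+2 = 2 * P + 2 * z + 2)%N by lia.
have -> : ((P + d + z).+1 = P + d + z + 1)%N by lia.
have -> : (P + 1 + z = P + z + 1)%N by lia.
have -> : (P + d + 2 * z + 1 = P + 1 + 2 * z + d)%N by lia.
have -> : (z + d = d + z)%N by lia.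
have -> : (x + 3 * P + 3 * z + 3 = (x + 3 * P + 3 * z + 2).+1)%N by lia.
have -> : (2 * x + 3 * P + 3 * z + 3 * d + 2 = (2 * x + 3 * P + 3 * z + 3 * d + 1).+1)%N by lia.
have -> : (-1) ^+ (P + z).*2.+1 = (-1) ^+ (P + d + z) * (-1) ^+ (y + z) :> rat.
  by rewrite -exprD; congr (_ ^+ _); lia.
have K1 : 2 * X + 3 * (P + z).*2.+1%:R + 2 = 2 * (x + 3 * P + 3 * z + 2)%:R + 1.
  by rewrite -[(P + z).*2.+1%:R]natr1 -mul2n natrM !natrD /X; ring.
have K2 : 2 * X + 3 * (P + d + z)%:R + 2 = (2 * x + 3 * P + 3 * z + 3 * d + 1)%:R + 1.
  by rewrite !natrD /X; ring.
rewrite natfact_double oddfactS (natfactS (_ + 1)) !addn0 K1 K2.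
have nz1 : 2 * (x + 3 * P + 3 * z + 2)%:R + 1 != 0 :> rat.
  by rewrite -natrM natr1 pnatr_eq0.
have nz2 := signr_eq0 rat (P + d + z); have nz3 := signr_eq0 rat (y + z).
have nz4 := signr_eq0 rat z.
have -> : natfact 0 = 1 by rewrite /natfact fact0.
have nz5 k : 2 ^+ k != 0 :> rat by rewrite expf_neq0.
field; rewrite !fact_neq0 !oddfact_neq0 nz2 nz3 nz4 !nz5 /=.
by rewrite -!natrM -!natrD -natrM natr1 pnatr_eq0.
Qed.
End Factorials.

(** * Pochhammer symbols as quotients of factorials *)

Lemma natfact_shift b n :
  \prod_(0 <= k < n) (b%:R + k%:R + 1) = natfact (b + n) / natfact b.
Proof.
elim: n => [|n IH]; first by rewrite big_geq // addn0 divff ?natfact_neq0.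
by rewrite big_nat_recr //= IH addnS natfactS natrD; ring.
Qed.

Lemma natfact_shift2 b n :
  \prod_(0 <= k < n) ((b%:R + 2 * k%:R + 1) * (b%:R + 2 * k%:R + 2))
  = natfact (b + 2 * n) / natfact b.
Proof.
elim: n => [|n IH]; first by rewrite big_geq // muln0 addn0 divff ?natfact_neq0.
rewrite big_nat_recr //= IH (_ : b + 2 * n.+1 = (b + 2 * n).+2)%N; last lia.
by rewrite !natfactS -[(b + 2 * n).+1%:R]natr1 natrD natrM; ring.
Qed.

Lemma natfact_shift3 b n :
  \prod_(0 <= k < n) ((b%:R + 3 * k%:R + 1) * (b%:R + 3 * k%:R + 2) * (b%:R + 3 * k%:R + 3))
  = natfact (b + 3 * n) / natfact b.
Proof.
elim: n => [|n IH]; first by rewrite big_geq // muln0 addn0 divff ?natfact_neq0.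
rewrite big_nat_recr //= IH (_ : b + 3 * n.+1 = (b + 3 * n).+3)%N; last lia.
rewrite !natfactS -[(b + 3 * n).+2%:R]natr1 -[(b + 3 * n).+1%:R]natr1.
by rewrite natrD natrM; ring.
Qed.

Lemma oddfact_shift b n :
  \prod_(0 <= k < n) (2 * (b%:R + k%:R) + 1) = oddfact (b + n) / oddfact b.
Proof.
elim: n => [|n IH]; first by rewrite big_geq // addn0 divff ?oddfact_neq0.
by rewrite big_nat_recr //= IH addnS oddfactS natrD; ring.
Qed.

Lemma prod_nat_rev (F : nat -> rat) n :
  \prod_(0 <= k < n) F (n - k.+1)%N = \prod_(0 <= k < n) F k.
Proof. by rewrite [RHS]big_nat_rev. Qed.

(** Indexing by the two ends [b] and [e] instead of the length gives one formula for both signs: for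
    [e < b] the convention for negative length is the inverted product from [e + 1] to [b]. *)
Lemma pochE b e : poch b.+1%:R (e%:Z - b%:Z) = natfact e / natfact b.
Proof.
have [le_be | lt_eb] := leqP b e.
  rewrite -[e in RHS](subnKC le_be) -natfact_shift subzn //= big_mkord.
  by apply: eq_bigr => k _; rewrite -[b.+1%:R]natr1; ring.
have -> : e%:Z - b%:Z = Negz (b - e).-1 by lia.
rewrite /= prednK ?subn_gt0 //.
have [d Ed] : exists d, b = (e + d)%N by exists (b - e)%N; lia.
rewrite Ed addKn; apply: (canLR (@invrK _)).
rewrite invfM invrK mulrC -natfact_shift -(prod_nat_rev (fun k => _ + k%:R + 1)).
rewrite big_mkord; apply: eq_bigr => k _; rewrite -natr1 natrD natrB //; ring.
Qed.

Lemma pochE' (X : rat) (n : int) b e : X = b.+1%:R -> n = e%:Z - b%:Z ->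
  poch X n = natfact e / natfact b.
Proof. by move=> -> ->; exact: pochE. Qed.

Lemma spochE (X : rat) b (n : nat) : X = 2 * b%:R + 1 ->
  spoch X n = oddfact (b + n) / oddfact b.
Proof.
move=> ->; rewrite -oddfact_shift /= big_mkord; apply: eq_bigr => k _; ring.
Qed.

Section ProductFormula.
Variable x : nat.
Let X : rat := x%:R.

Lemma E1_facE d j : E1_fac X (6 * d%:R) j.+1 =
  natfact (2 * x + 6 * d + 3 * j + 2) / natfact (2 * x + 6 * d + 2 * j + 1)
  * (oddfact (x + 3 * d + 3 * j + 2) / oddfact (x + 3 * d + 2 * j + 2))
  / (natfact (2 * j + 1) / natfact j
     * (oddfact (x + 3 * d + 2 * j + 1) / oddfact (x + 3 * d + j + 1))).
Proof.
rewrite /E1_fac (_ : j.+1%:Z - 1 = j%:Z :> int); last lia.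
rewrite (@pochE' _ _ (2 * x + 6 * d + 2 * j + 1) (2 * x + 6 * d + 3 * j + 2)); first last.
- lia.
- by rewrite -[RHS]natr1 -[j.+1%:R]natr1 !natrD /X; ring.
rewrite (@pochE' _ _ j (2 * j + 1)) //; last lia.
rewrite (@spochE _ (x + 3 * d + 2 * j + 2)); last first.
  by rewrite -[j.+1%:R]natr1 !natrD /X; ring.
rewrite (@spochE _ (x + 3 * d + j + 1)); last first.
  by rewrite -[j.+1%:R]natr1 !natrD /X; ring.
congr (_ * (oddfact _ / _) / (_ * (oddfact _ / _))); lia.
Qed.

(** The growth of the last product of [E1] when [z] increases by one. In terms of [P = y + d - 1] it
    also makes sense for [y = 0], where [E1] has no such product and the ratio is 1. *)
Definition zratio P y z d : rat :=
  natfact (P + 1 + z) / natfact (y + z) / (natfact (z + d) / natfact z)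
  * (natfact (2 * x + 4 * P + 2 * z + 2 * d + 1) / natfact (2 * x + 4 * P + 2 * z + 1))
  / (natfact (2 * x + 3 * P + 2 * z + 3 * d + 1) / natfact (2 * x + 3 * P + 2 * z + d + 1))
  / (natfact (2 * P + 2 * z + 2) / natfact (2 * y + 2 * z))
  * (natfact (P + 1 + 2 * z + d) / natfact (y + 2 * z))
  / (natfact (x + 2 * P + z + d) / natfact (x + 2 * P + z))
  * (natfact (x + P + z + 2 * d) / natfact (x + P + z + d)).

Lemma teethratio_E1_fac P y z d j : (y + d = P.+1)%N -> (y + z = j.+1)%N ->
  teethratio x P (P + d) z = E1_fac X (6 * d%:R) j.+1 / 2 * zratio P y z d.
Proof.
move=> E1 E2; rewrite (@teethratioE x P y z d) // E1_facE /zratio.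
have -> : (2 * x + 6 * d + 3 * j + 2 = 2 * x + 3 * P + 3 * z + 3 * d + 2)%N by lia.
have -> : (2 * x + 6 * d + 2 * j + 1 = (2 * (x + P + z + 2 * d)).+1)%N by lia.
have -> : (x + 3 * d + j + 1 = (x + P + z + 2 * d).+1)%N by lia.
have -> : (x + 3 * d + 3 * j + 2 = x + 3 * P + 3 * z + 2)%N by lia.
have -> : (x + 3 * d + 2 * j + 2 = x + 2 * P + 2 * z + d + 2)%N by lia.
have -> : (x + 3 * d + 2 * j + 1 = x + 2 * P + 2 * z + d + 1)%N by lia.
have -> : (2 * x + 4 * P + 2 * z + 2 * d + 1 = (2 * (x + 2 * P + z + d)).+1)%N by lia.
have -> : (2 * x + 4 * P + 2 * z + 1 = (2 * (x + 2 * P + z)).+1)%N by lia.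
have -> : (2 * y + 2 * z = (2 * j + 1).+1)%N by lia.
have -> : (P + z + 1 = P + 1 + z)%N by lia.
have -> : (d + z = z + d)%N by lia.
have -> : (x + 2 * P + z + d + 1 = (x + 2 * P + z + d).+1)%N by lia.
have -> : (x + 2 * P + z + 1 = (x + 2 * P + z).+1)%N by lia.
rewrite !natfact_doubleS E2 !natfactS.
have nz5 k : 2 ^+ k != 0 :> rat by rewrite expf_neq0.
have E3 : 2 ^+ (x + 2 * P + 2 * z + 1) * 2 ^+ (x + 2 * P + z + d) = 2 ^+ j.+1 * 2 ^+ (x + P + z + 2 * d) * 2 ^+ (x + 2 * P + z) :> rat.
  by rewrite -!exprD; congr (_ ^+ _); lia.
have -> : 2 ^+ (x + 2 * P + 2 * z + 1) = 2 ^+ j.+1 * 2 ^+ (x + P + z + 2 * d)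
  * 2 ^+ (x + 2 * P + z) / 2 ^+ (x + 2 * P + z + d) :> rat by rewrite -E3 mulfK.
have -> : (2 * j + 1)%:R = 2 * j%:R + 1 :> rat by rewrite natrD natrM.
have j1 : j%:R + 1 != 0 :> rat by rewrite natr1 pnatr_eq0.
have j2 : 2 * j%:R + 1 + 1 != 0 :> rat.
  by rewrite (_ : _ + 1 = 2 * (j%:R + 1)) ?mulf_neq0 //; ring.
by field; rewrite !fact_neq0 !oddfact_neq0 !nz5 j1 j2.
Qed.

Lemma zratio_y0 P z : zratio P 0 z P.+1 = 1.
Proof.
rewrite /zratio.
have -> : (2 * x + 4 * P + 2 * z + 2 * P.+1 + 1 = 2 * x + 6 * P + 2 * z + 3)%N by lia.
have -> : (2 * x + 3 * P + 2 * z + 3 * P.+1 + 1 = (2 * x + 6 * P + 2 * z + 3).+1)%N by lia.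
have -> : (2 * x + 3 * P + 2 * z + P.+1 + 1 = (2 * x + 4 * P + 2 * z + 1).+1)%N by lia.
have -> : (P + 1 + z = z + P.+1)%N by lia.
have -> : (2 * P + 2 * z + 2 = P + 1 + 2 * z + P.+1)%N by lia.
have -> : (x + 2 * P + z + P.+1 = x + 3 * P + z + 1)%N by lia.
have -> : (x + P + z + 2 * P.+1 = (x + 3 * P + z + 1).+1)%N by lia.
have -> : (x + P + z + P.+1 = (x + 2 * P + z).+1)%N by lia.
rewrite !natfactS !(muln0, add0n).
have k1 k : k%:R + 1 != 0 :> rat by rewrite natr1 pnatr_eq0.
have [px pP pz] := And3 (ler0n rat x) (ler0n rat P) (ler0n rat z).
have n1 : 2 * x%:R + 6 * P%:R + 2 * z%:R + 3 + 1 != 0 :> rat.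
  by apply: lt0r_neq0; lra.
have n2 : x%:R + 2 * P%:R + z%:R + 1 != 0 :> rat.
  by apply: lt0r_neq0; lra.
have -> : (2 * x + 6 * P + 2 * z + 3)%:R = 2 * x%:R + 6 * P%:R + 2 * z%:R + 3 :> rat.
  by rewrite !natrD; ring.
have -> : (2 * x + 4 * P + 2 * z + 1)%:R = 2 * x%:R + 4 * P%:R + 2 * z%:R + 1 :> rat.
  by rewrite !natrD; ring.
have -> : (x + 3 * P + z + 1)%:R = x%:R + 3 * P%:R + z%:R + 1 :> rat.
  by rewrite !natrD; ring.
have -> : (x + 2 * P + z)%:R = x%:R + 2 * P%:R + z%:R :> rat.
  by rewrite !natrD; ring.
by field; rewrite !fact_neq0 n1 n2 /= andbT; apply: lt0r_neq0; lra.
Qed.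

Lemma zratio_d0 P z : zratio P P.+1 z 0 = 1.
Proof.
rewrite /zratio !(muln0, addn0).
have -> : (P + 1 + z = P.+1 + z)%N by lia.
have -> : (2 * P + 2 * z + 2 = 2 * P.+1 + 2 * z)%N by lia.
have -> : (P + 1 + 2 * z = P.+1 + 2 * z)%N by lia.
by rewrite !divff ?natfact_neq0 // ?invr1 ?mulr1.
Qed.

(** The factor of index [i.+1] in the last product of [E1] at [y.+1]. The ends of the Pochhammer
    symbols are expressed through [i] or [a - i.+1]; these run over the same set, so the product may
    be reversed in part of the factors. *)
Definition E1_term (y z a i : nat) : rat :=
  natfact (z + y + 1 + (a - i.+1)) / natfact (z + i)
  * (natfact (2 * x + 4 * y + 2 * z + 4 * a + 2 * (a - i.+1) + 1)
     / natfact (2 * x + 3 * y + 2 * z + 4 * a + 2 * i + 1))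
  * (natfact (x + y + a + (a - i.+1)) / natfact (x + a + i))
  * (natfact (2 * x + 3 * y + 4 * a + 2 * i + 1)
     / natfact (2 * x + 3 * y + 3 * a + 3 * i + 2))
  / (natfact (2 * i + 1 + y) / natfact (2 * i + 1)
     * (natfact (2 * y + 2 * z + 2 * (a - i.+1) + 2) / natfact (y + 2 * z + 2 * i + 1))
     * (natfact (x + 2 * y + z + 2 * a + (a - i.+1)) / natfact (x + y + z + 2 * a + i))
     * (natfact (2 * x + 4 * a + 2 * i + 1) / natfact (2 * x + 3 * a + 3 * i + 2))).

Lemma E1_pos y z a : E1 x y.+1 z a =
  (2 ^+ (y + z))^-1 * (\prod_(0 <= i < a) E1_fac X 0 i.+1)
  * (\prod_(0 <= i < y + z) E1_fac X (6 * a%:R) i.+1)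
  * \prod_(0 <= i < a) E1_term y z a i.
Proof.
rewrite /E1; cbv zeta; rewrite (_ : (y.+1 == 0%N) = false) //.
cbv iota; rewrite !big_add1 -!pred_Sn -/X.
have -> : (2 : rat) ^ (y.+1%:Z + z%:Z - 1) = 2 ^+ (y + z).
  by rewrite (_ : _ - 1 = (y + z)%N%:Z) //; lia.
congr (_ * _ * _ * _); apply: eq_big_nat => i /andP[_ lt_ia].
have [e Ea] : exists e, a = (i.+1 + e)%N by exists (a - i.+1)%N; lia.
have Ee : (a - i.+1 = e)%N by lia.
rewrite /E1_term Ee.
rewrite (@pochE' _ _ (z + i) (z + y + 1 + e)); first last.
- lia.
- by rewrite -[(z + i).+1%:R]natr1 -[i.+1%:R]natr1 natrD; ring.
rewrite (@pochE' _ _ (2 * x + 3 * y + 2 * z + 4 * a + 2 * i + 1)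
  (2 * x + 4 * y + 2 * z + 4 * a + 2 * e + 1)); first last.
- lia.
- rewrite -[_.+1%:R in RHS]natr1 -[i.+1%:R]natr1 -[y.+1%:R]natr1 !natrD /X; ring.
rewrite (@pochE' _ _ (x + a + i) (x + y + a + e)); first last.
- lia.
- rewrite -[_.+1%:R in RHS]natr1 -[i.+1%:R]natr1 !natrD /X; ring.
rewrite (@pochE' _ _ (2 * x + 3 * y + 3 * a + 3 * i + 2) (2 * x + 3 * y + 4 * a + 2 * i + 1)); first last.
- lia.
- rewrite -[_.+1%:R in RHS]natr1 -[i.+1%:R]natr1 -[y.+1%:R]natr1 !natrD /X; ring.
rewrite (@pochE' (2 * i.+1%:R) _ (2 * i + 1) (2 * i + 1 + y)); first last.
- lia.
- rewrite -[_.+1%:R in RHS]natr1 -[i.+1%:R]natr1 !natrD; ring.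
rewrite (@pochE' _ _ (y + 2 * z + 2 * i + 1) (2 * y + 2 * z + 2 * e + 2)); first last.
- lia.
- rewrite -[_.+1%:R in RHS]natr1 -[i.+1%:R]natr1 -[y.+1%:R]natr1 !natrD /X; ring.
rewrite (@pochE' _ _ (x + y + z + 2 * a + i) (x + 2 * y + z + 2 * a + e)); first last.
- lia.
- rewrite -[_.+1%:R in RHS]natr1 -[i.+1%:R]natr1 -[y.+1%:R]natr1 !natrD /X; ring.
rewrite (@pochE' _ _ (2 * x + 3 * a + 3 * i + 2) (2 * x + 4 * a + 2 * i + 1)) //; first last.
- lia.
- rewrite -[_.+1%:R in RHS]natr1 -[i.+1%:R]natr1 !natrD /X; ring.
Qed.

Definition lin1 (b k : nat) : rat := b%:R + k%:R + 1.
Definition lin2 (b k : nat) : rat := (b%:R + 2 * k%:R + 1) * (b%:R + 2 * k%:R + 2).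

Lemma lin1_neq0 b k : lin1 b k != 0.
Proof. by rewrite /lin1 -natrD natr1 pnatr_eq0. Qed.

Lemma lin2_neq0 b k : lin2 b k != 0.
Proof.
have [pb pk] := (ler0n rat b, ler0n rat k).
by rewrite mulf_neq0 //; apply: lt0r_neq0; lra.
Qed.

Lemma natfact_lin1 b k m : m = (b + k).+1 -> natfact m = lin1 b k * natfact (b + k).
Proof. by move=> ->; rewrite natfactS natrD. Qed.

Lemma natfact_lin2 b k m : m = (b + 2 * k).+2 ->
  natfact m = lin2 b k * natfact (b + 2 * k).
Proof.
by move=> ->; rewrite !natfactS -natr1 natrD natrM /lin2; ring.
Qed.

Lemma E1_term_zS y z a i : (i < a)%N ->
  E1_term y z.+1 a i = E1_term y z a i
  * (lin1 (z + y + 1) (a - i.+1) / lin1 z i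
     * (lin2 (2 * x + 4 * y + 2 * z + 4 * a + 1) (a - i.+1)
        / lin2 (2 * x + 3 * y + 2 * z + 4 * a + 1) i)
     / (lin2 (2 * y + 2 * z + 2) (a - i.+1) / lin2 (y + 2 * z + 1) i)
     / (lin1 (x + 2 * y + z + 2 * a) (a - i.+1) / lin1 (x + y + z + 2 * a) i)).
Proof.
move=> lt_ia; have [e Ea] : exists e, (a - i.+1)%N = e by exists (a - i.+1)%N.
rewrite /E1_term Ea.
rewrite (@natfact_lin1 (z + y + 1) e (z.+1 + y + 1 + e)); last lia.
rewrite (@natfact_lin1 z i (z.+1 + i)); last lia.
rewrite (@natfact_lin2 (2 * x + 4 * y + 2 * z + 4 * a + 1) e
  (2 * x + 4 * y + 2 * z.+1 + 4 * a + 2 * e + 1)); last lia.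
rewrite (@natfact_lin2 (2 * x + 3 * y + 2 * z + 4 * a + 1) i
  (2 * x + 3 * y + 2 * z.+1 + 4 * a + 2 * i + 1)); last lia.
rewrite (@natfact_lin2 (2 * y + 2 * z + 2) e (2 * y + 2 * z.+1 + 2 * e + 2)); last lia.
rewrite (@natfact_lin2 (y + 2 * z + 1) i (y + 2 * z.+1 + 2 * i + 1)); last lia.
rewrite (@natfact_lin1 (x + 2 * y + z + 2 * a) e (x + 2 * y + z.+1 + 2 * a + e)); last lia.
rewrite (@natfact_lin1 (x + y + z + 2 * a) i (x + y + z.+1 + 2 * a + i)); last lia.
have -> : (2 * x + 4 * y + 2 * z + 4 * a + 1 + 2 * e = 2 * x + 4 * y + 2 * z + 4 * a + 2 * e + 1)%N by lia.
have -> : (2 * x + 3 * y + 2 * z + 4 * a + 1 + 2 * i = 2 * x + 3 * y + 2 * z + 4 * a + 2 * i + 1)%N by lia.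
have -> : (2 * y + 2 * z + 2 + 2 * e = 2 * y + 2 * z + 2 * e + 2)%N by lia.
have -> : (y + 2 * z + 1 + 2 * i = y + 2 * z + 2 * i + 1)%N by lia.
by field; rewrite !fact_neq0 !lin1_neq0 !lin2_neq0.
Qed.

Lemma prod_quotients (T A B C D E G H K : nat -> rat) n :
  \prod_(0 <= k < n) (T k * (A k / B k * (C k / D k) / (E k / G k) / (H k / K k))) =
  \prod_(0 <= k < n) T k * (\prod_(0 <= k < n) A k / \prod_(0 <= k < n) B k
   * (\prod_(0 <= k < n) C k / \prod_(0 <= k < n) D k)
   / (\prod_(0 <= k < n) E k / \prod_(0 <= k < n) G k)
   / (\prod_(0 <= k < n) H k / \prod_(0 <= k < n) K k)).
Proof. by rewrite !(big_split, prodfV) /=. Qed.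

(** After reversal of the factors in [a - i.+1], the linear factors run through consecutive integers
    and collapse to quotients of factorials. *)
Lemma prod_E1_term_zS y z a :
  \prod_(0 <= i < a) E1_term y z.+1 a i =
  \prod_(0 <= i < a) E1_term y z a i * zratio (y + a) y.+1 z a.
Proof.
under eq_big_nat => i /andP[_ lt_ia] do rewrite E1_term_zS //.
rewrite prod_quotients !(prod_nat_rev (lin1 _)) !(prod_nat_rev (lin2 _)).
rewrite !natfact_shift !natfact_shift2 /zratio; congr (_ * _).
have -> : (y + a + 1 + z = z + y + 1 + a)%N by lia.
have -> : (y.+1 + z = z + y + 1)%N by lia.
have -> : (2 * x + 4 * (y + a) + 2 * z + 2 * a + 1 = 2 * x + 4 * y + 2 * z + 4 * a + 1 + 2 * a)%N by lia.
have -> : (2 * x + 4 * (y + a) + 2 * z + 1 = 2 * x + 4 * y + 2 * z + 4 * a + 1)%N by lia.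
have -> : (2 * x + 3 * (y + a) + 2 * z + 3 * a + 1 = 2 * x + 3 * y + 2 * z + 4 * a + 1 + 2 * a)%N by lia.
have -> : (2 * x + 3 * (y + a) + 2 * z + a + 1 = 2 * x + 3 * y + 2 * z + 4 * a + 1)%N by lia.
have -> : (2 * (y + a) + 2 * z + 2 = 2 * y + 2 * z + 2 + 2 * a)%N by lia.
have -> : (2 * y.+1 + 2 * z = 2 * y + 2 * z + 2)%N by lia.
have -> : (y + a + 1 + 2 * z + a = y + 2 * z + 1 + 2 * a)%N by lia.
have -> : (y.+1 + 2 * z = y + 2 * z + 1)%N by lia.
have -> : (x + 2 * (y + a) + z + a = x + 2 * y + z + 2 * a + a)%N by lia.
have -> : (x + 2 * (y + a) + z = x + 2 * y + z + 2 * a)%N by lia.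
have -> : (x + (y + a) + z + 2 * a = x + y + z + 2 * a + a)%N by lia.
have -> : (x + (y + a) + z + a = x + y + z + 2 * a)%N by lia.
by field; rewrite !fact_neq0.
Qed.

Lemma E1_term_z0 y a i : (i < a)%N -> E1_term y 0 a i =
  natfact (y + 1 + (a - i.+1)) / natfact i
  * (natfact (2 * x + 4 * y + 4 * a + 2 * (a - i.+1) + 1)
     / natfact (2 * x + 3 * y + 3 * a + 3 * i + 2))
  * (natfact (x + y + a + (a - i.+1)) / natfact (x + a + i))
  / (natfact (2 * y + 2 * (a - i.+1) + 2) / natfact (2 * i + 1)
     * (natfact (x + 2 * y + 2 * a + (a - i.+1)) / natfact (x + y + 2 * a + i))
     * (natfact (2 * x + 4 * a + 2 * i + 1) / natfact (2 * x + 3 * a + 3 * i + 2))).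
Proof.
move=> lt_ia; rewrite /E1_term muln0 !addn0 add0n.
have -> : (2 * i + 1 + y = y + 2 * i + 1)%N by lia.
by field; rewrite !fact_neq0.
Qed.

Definition lin3 (b k : nat) : rat :=
  (b%:R + 3 * k%:R + 1) * (b%:R + 3 * k%:R + 2) * (b%:R + 3 * k%:R + 3).
Definition linodd (b k : nat) : rat := 2 * (b%:R + k%:R) + 1.

(** The step adds four consecutive integers to the largest factorial depending on [a - i.+1]. The
    two even ones cancel, up to powers of 2, against the step of [x + 2y + 2a + e] with
    [e = a - i.+1]; the two odd ones are the factors [linodd] of the numerator. *)
Lemma E1_term_yS y a i : (i < a)%N ->
  E1_term y.+1 0 a i = E1_term y 0 a i
  * (2 * linodd (x + 2 * y + 2 * a + 1) (a - i.+1)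
     * linodd (x + 2 * y + 2 * a + 2) (a - i.+1)
     * lin1 (x + y + a) (a - i.+1) * lin1 (x + y + 2 * a) i
     / (lin3 (2 * x + 3 * y + 3 * a + 2) i * linodd (y + 1) (a - i.+1))).
Proof.
move=> lt_ia; rewrite !E1_term_z0 //.
have [e Ea] : exists e, (a - i.+1)%N = e by exists (a - i.+1)%N.
rewrite Ea (_ : y.+1 + 1 + e = (y + 1 + e).+1)%N; last lia.
rewrite (_ : 2 * x + 4 * y.+1 + 4 * a + 2 * e + 1
  = (2 * x + 4 * y + 4 * a + 2 * e + 1).+4)%N; last lia.
rewrite (_ : 2 * x + 3 * y.+1 + 3 * a + 3 * i + 2
  = (2 * x + 3 * y + 3 * a + 3 * i + 2).+3)%N; last lia.
rewrite (_ : x + y.+1 + a + e = (x + y + a + e).+1)%N; last lia.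
rewrite (_ : 2 * y.+1 + 2 * e + 2 = (2 * y + 2 * e + 2).+2)%N; last lia.
rewrite (_ : x + 2 * y.+1 + 2 * a + e = (x + 2 * y + 2 * a + e).+2)%N; last lia.
rewrite (_ : x + y.+1 + 2 * a + i = (x + y + 2 * a + i).+1)%N; last lia.
rewrite !natfactS.
set u1 := natfact (2 * x + 4 * y + 4 * a + 2 * e + 1).
set u2 := natfact (2 * x + 3 * y + 3 * a + 3 * i + 2).
have SN (n : nat) : n.+1%:R = n%:R + 1 :> rat by rewrite natr1.
rewrite !(SN (2 * x + 4 * y + 4 * a + 2 * e + 1).+2, SN (2 * x + 4 * y + 4 * a + 2 * e + 1).+1,
  SN (2 * x + 4 * y + 4 * a + 2 * e + 1)%N, SN (2 * x + 3 * y + 3 * a + 3 * i + 2).+1,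
  SN (2 * x + 3 * y + 3 * a + 3 * i + 2)%N, SN (2 * y + 2 * e + 2)%N,
  SN (x + 2 * y + 2 * a + e)%N).
rewrite /linodd /lin1 /lin3.
have [px py pa pi pe] := And5 (ler0n rat x) (ler0n rat y) (ler0n rat a) (ler0n rat i) (ler0n rat e).
field; rewrite /u1 /u2 !fact_neq0 /=.
do ?[apply/andP; split => //]; try by apply: lt0r_neq0; lra.
Qed.

Lemma prod_E1_term_y0 a : \prod_(0 <= i < a) E1_term 0 0 a i = (2 ^+ a)^-1.
Proof.
(* The term of index [i] is [F (a - i.+1) / F i / 2], so that under reversal only the powers of 2
   survive. *)
pose F k := natfact (k + 1) * natfact (2 * x + 4 * a + 2 * k + 1)
  * natfact (x + a + k) / (natfact (2 * k + 2) * natfact (x + 2 * a + k)).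
have F0 k : F k != 0.
  by rewrite /F mulf_neq0 ?invr_eq0 // !mulf_neq0 ?natfact_neq0.
transitivity (\prod_(0 <= i < a) (F (a - i.+1)%N / F i / 2)).
  apply: eq_big_nat => i /andP[_ lt_ia]; rewrite E1_term_z0 //.
  have [e Ea] : exists e, (a - i.+1)%N = e by exists (a - i.+1)%N.
  rewrite Ea /F !muln0 !addn0 !add0n [(1 + e)%N]addnC.
  have -> : (2 * x + 4 * a + 2 * i + 1 = 2 * x + 3 * a + 3 * i + 2 + e)%N by lia.
  have -> : natfact (2 * i + 2) = 2 * (i%:R + 1) * natfact (2 * i + 1).
    by rewrite addn2 addn1 natfactS -[(2 * i).+1%:R]natr1 natrM; ring.
  have -> : natfact (i + 1) = (i%:R + 1) * natfact i by rewrite addn1 natfactS.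
  have i1 : i%:R + 1 != 0 :> rat by rewrite natr1 pnatr_eq0.
  by field; rewrite !fact_neq0 i1.
have -> (A B : nat -> rat) : \prod_(0 <= k < a) (A k / B k / 2) =
    \prod_(0 <= k < a) A k / \prod_(0 <= k < a) B k / 2 ^+ a.
  by rewrite !big_split !prodfV prodr_const_nat subn0.
rewrite prod_nat_rev divff ?mul1r //.
by apply: prod_nat_neq0 => k _.
Qed.

Definition yratio (y a : nat) : rat :=
  2 ^+ a * (oddfact (x + 2 * y + 3 * a + 1) / oddfact (x + 2 * y + 2 * a + 1))
  * (oddfact (x + 2 * y + 3 * a + 2) / oddfact (x + 2 * y + 2 * a + 2))
  * (natfact (x + y + 2 * a) / natfact (x + y + a))
  * (natfact (x + y + 3 * a) / natfact (x + y + 2 * a))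
  / (natfact (2 * x + 3 * y + 6 * a + 2) / natfact (2 * x + 3 * y + 3 * a + 2)
     * (oddfact (y + 1 + a) / oddfact (y + 1))).

Lemma prod_E1_term_yS y a : \prod_(0 <= i < a) E1_term y.+1 0 a i =
  \prod_(0 <= i < a) E1_term y 0 a i * yratio y a.
Proof.
under eq_big_nat => i /andP[_ lt_ia] do rewrite E1_term_yS //.
have -> (T A B C D E G : nat -> rat) :
  \prod_(0 <= k < a) (T k * (2 * A k * B k * C k * D k / (E k * G k))) =
  \prod_(0 <= k < a) T k * (2 ^+ a * \prod_(0 <= k < a) A k * \prod_(0 <= k < a) B k
    * \prod_(0 <= k < a) C k * \prod_(0 <= k < a) D k
    / (\prod_(0 <= k < a) E k * \prod_(0 <= k < a) G k)).
  by rewrite -[a in 2 ^+ a]subn0 -prodr_const_nat -!big_split -prodfV -!big_split.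
rewrite !(prod_nat_rev (lin1 _)) !(prod_nat_rev (linodd _)).
rewrite !natfact_shift natfact_shift3 !oddfact_shift /yratio; congr (_ * _).
have -> : (x + 2 * y + 2 * a + 1 + a = x + 2 * y + 3 * a + 1)%N by lia.
have -> : (x + 2 * y + 2 * a + 2 + a = x + 2 * y + 3 * a + 2)%N by lia.
have -> : (x + y + a + a = x + y + 2 * a)%N by lia.
have -> : (x + y + 2 * a + a = x + y + 3 * a)%N by lia.
by have -> : (2 * x + 3 * y + 3 * a + 2 + 3 * a = 2 * x + 3 * y + 6 * a + 2)%N by lia.
Qed.

Lemma E1_fac0E j : E1_fac X 0 j.+1 =
  natfact (2 * x + 3 * j + 2) / natfact (2 * x + 2 * j + 1)
  * (oddfact (x + 3 * j + 2) / oddfact (x + 2 * j + 2))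
  / (natfact (2 * j + 1) / natfact j
     * (oddfact (x + 2 * j + 1) / oddfact (x + j + 1))).
Proof.
by have := E1_facE 0 j; rewrite mulr0 !muln0 !addn0.
Qed.

(** This merges the two products of [E1] at [z = 0]: each increase of [y] lengthens the single
    product of the factors [E1_fac X 0]. *)
Lemma E1_fac_yratio y a :
  E1_fac X (6 * a%:R) y.+1 * yratio y a = E1_fac X 0 (y + a).+1.
Proof.
rewrite E1_fac0E E1_facE /yratio.
have -> : (2 * x + 6 * a + 2 * y + 1 = (2 * (x + y + 3 * a)).+1)%N by lia.
have -> : (x + 3 * a + y + 1 = (x + y + 3 * a).+1)%N by lia.
have -> : (2 * x + 2 * (y + a) + 1 = (2 * (x + y + a)).+1)%N by lia.
have -> : (x + (y + a) + 1 = (x + y + a).+1)%N by lia.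
rewrite !addn1 addSn.
rewrite !natfact_doubleS.
have -> : (2 * x + 3 * (y + a) + 2 = 2 * x + 3 * y + 3 * a + 2)%N by lia.
have -> : (2 * x + 6 * a + 3 * y + 2 = 2 * x + 3 * y + 6 * a + 2)%N by lia.
have -> : (x + 3 * a + 3 * y + 2 = x + 3 * (y + a) + 2)%N by lia.
have -> : (x + 3 * a + 2 * y + 2 = x + 2 * y + 3 * a + 2)%N by lia.
have -> : (x + 2 * (y + a) + 2 = x + 2 * y + 2 * a + 2)%N by lia.
have -> : (x + 3 * a + 2 * y).+1 = (x + 2 * y + 3 * a).+1 by lia.
have -> : (x + 2 * (y + a)).+1 = (x + 2 * y + 2 * a).+1 by lia.
have -> : (x + y + 3 * a = x + y + a + (a + a))%N by lia.
rewrite !(exprD _ (x + y + a)%N (a + a)%N, exprD _ a a, exprD _ y a).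
by field; rewrite !fact_neq0 !oddfact_neq0 !expf_neq0.
Qed.

Lemma E1_z0 y a :
  E1 x y.+1 0 a = (2 ^+ (y + a))^-1 * \prod_(0 <= i < y + a) E1_fac X 0 i.+1.
Proof.
rewrite E1_pos addn0; elim: y => [|y IH].
  by rewrite (@big_geq _ _ _ 0 0) // prod_E1_term_y0 expr0 invr1 mul1r mulr1 add0n mulrC.
rewrite prod_E1_term_yS big_nat_recr //= addSn big_nat_recr //= -E1_fac_yratio.
rewrite !exprS !invfM; move: IH (E1_fac X (6 * a%:R) y.+1) (yratio y a).
move: (\prod_(0 <= i < a) _) (\prod_(0 <= i < y) _) (\prod_(0 <= i < a) _).
move: (\prod_(0 <= i < y + a) _) (2 ^+ y)^-1 (2 ^+ (y + a))^-1 => u v w r s t IH f k.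
by transitivity (2^-1 * (v * t * s * r) * (f * k)); [ring | rewrite IH; ring].
Qed.

Lemma E1_y0 z a : E1 x 0 z.+1 a.+1 =
  (2 ^+ (a + z))^-1 * (\prod_(0 <= i < a) E1_fac X 0 i.+1)
  * \prod_(0 <= i < z) E1_fac X (6 * a.+1%:R) i.+1.
Proof.
rewrite /E1; cbv zeta; rewrite eqxx; cbv iota; rewrite !big_add1 -!pred_Sn -/X.
by have -> : a.+1%:Z + z.+1%:Z - 2 = (a + z)%N%:Z :> int by lia.
Qed.

Lemma teethdet_z0 P q : teethdet x P q 0 =
  (2 ^+ P)^-1 * \prod_(0 <= i < P) E1_fac X 0 i.+1.
Proof.
have detE n n' (F F' : nat -> nat -> rat) : n = n' ->
    (forall i t, (t < n)%N -> F i t = F' i t) ->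
    \det (\matrix_(i < n, t < n) F i t) = \det (\matrix_(i < n', t < n') F' i t).
  move=> <- eqF; congr (\det _); apply/matrixP => i t.
  by rewrite !mxE eqF.
elim: P q => [|P IH] q; first by rewrite /teethdet det_mx00 big_geq // expr0 invr1 mulr1.
(* A single block of [P.+1] columns is also a block of [P] columns followed by a contiguous block of
   one column, to which the ratio in [z] applies. *)
transitivity (teethdet x P P 1).
  rewrite /teethdet; apply: (detE _ _ (fun i t => pathmx x i (teeth P.+1 q t))
    (fun i t => pathmx x i (teeth P P t))) => [|i t lt_t]; first by rewrite addn0 addn1.
  rewrite /teeth; have -> : (t < P.+1)%N by lia.
  by case: ltnP => // le_Pt; congr (pathmx _ _ _); lia.
rewrite teethdetS ?IH; last by lia.
have -> : teethratio x P P 0 = E1_fac X 0 P.+1 / 2.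
  have := @teethratio_E1_fac P P.+1 0 0 P.
  by rewrite !addn0 mulr0 zratio_d0 mulr1 => ->.
rewrite big_nat_recr //= exprS invfM.
move: (\prod_(0 <= i < P) _) (2 ^+ P)^-1 => *; ring.
Qed.

Lemma E1_teethdet y z a : (1 <= y + z)%N -> (1 <= y + a)%N ->
  E1 x y z a = teethdet x (y + a - 1) (y + 2 * a - 1) z.
Proof.
case: y => [|y] hz ha.
  case: z hz => // z _; case: a ha => // a _.
  have -> : (0 + a.+1 - 1 = a)%N by lia.
  have -> : (0 + 2 * a.+1 - 1 = a + a.+1)%N by lia.
  rewrite E1_y0; elim: z => [|z IH].
    (* [teethratio_E1_fac] needs [y + z] positive, so the first tooth of the second block is treated
       apart. It is column [2a + 1], whose only non-zero entry is a 1 in the last row [a];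
       accordingly the ratio is 1. *)
    rewrite teethdetS ?teethdet_z0; last lia.
    rewrite (@big_geq _ _ _ 0 0) // (@teethratioE x a 0 0 a.+1) //.
    rewrite [(0 + 0)%N]/= expr0 [(0 + 2 * 0)%N]/=.
    have -> : (2 * x + 3 * a + 3 * 0 + 3 * a.+1 + 2 = (2 * x + 6 * a + 4).+1)%N by lia.
    have -> : (2 * x + 3 * a + 2 * 0 + 3 * a.+1 + 1 = 2 * x + 6 * a + 4)%N by lia.
    have -> : (2 * x + 3 * a + 2 * 0 + a.+1 + 1 = 2 * (x + 2 * a + 1))%N by lia.
    have -> : (x + a + 0 + a.+1 = x + 2 * a + 1)%N by lia.
    have -> : (x + 2 * a + 2 * 0 + 1 = x + 2 * a + 1)%N by lia.
    have -> : (x + 2 * a + 2 * 0 + a.+1 + 2 = (x + 3 * a + 2).+1)%N by lia.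
    have -> : (x + 2 * a + 2 * 0 + a.+1 + 1 = x + 3 * a + 2)%N by lia.
    have -> : (x + 3 * a + 3 * 0 + 2 = x + 3 * a + 2)%N by lia.
    have -> : (a + 1 + 2 * 0 + a.+1 = 2 * a + 2 * 0 + 2)%N by lia.
    have -> : (a.+1 + 0 = a + 0 + 1)%N by lia.
    rewrite natfact_double natfactS oddfactS.
    rewrite (_ : (2 * x + 6 * a + 4)%:R + 1 = 2 * (x + 3 * a + 2)%:R + 1); last first.
      by rewrite !natrD; ring.
    rewrite [X in _ = _ * X](_ : _ = 1); first by rewrite !mulr1 addn0.
    have px := ler0n rat x; have pa := ler0n rat a.
    field; rewrite !fact_neq0 !oddfact_neq0 expf_neq0 //= andbT.
    by apply: lt0r_neq0; lra.
  rewrite teethdetS -?IH; last lia.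
  rewrite (@teethratio_E1_fac a 0 z.+1 a.+1 z) // zratio_y0 mulr1.
  rewrite big_nat_recr //= addnS exprS invfM.
  by move: (\prod_(0 <= i < a) _) (\prod_(0 <= i < z) _) (2 ^+ _)^-1 => *; ring.
have -> : (y.+1 + a - 1 = y + a)%N by lia.
have -> : (y.+1 + 2 * a - 1 = y + a + a)%N by lia.
elim: z {hz} => [|z IH]; first by rewrite E1_z0 teethdet_z0.
rewrite teethdetS -?IH; last lia.
rewrite (@teethratio_E1_fac (y + a) y.+1 z a (y + z)) //.
rewrite !E1_pos prod_E1_term_zS addnS exprS invfM big_nat_recr //=.
move: (\prod_(0 <= i < a) _) (\prod_(0 <= i < y + z) _) (\prod_(0 <= i < a) _).
by move: (2 ^+ _)^-1 => *; ring.
Qed.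
End ProductFormula.

Local Close Scope ring_scope.

(** * The pentagon with removed triangles *)

Section Region.
Variables (x y z a : nat).
Hypotheses (yz : 1 <= y + z) (ya : 1 <= y + a).
Let P := y + a - 1.
Let q := y + 2 * a - 1.
Let n := P + z.
Let K := E_row_max x y z a.
Let N := E_window x y z a.

(** The final frontier begins with the [x] edges of the northern side; after them the teeth
    alternate with the horizontal edges of the northeastern zig-zag. *)
Definition toothpos (i : 'I_n) : nat := x + 2 * teeth P q i.

Lemma region_height : E_height y z a = n.*2.
Proof. by rewrite /E_height /n /P; lia. Qed.

Lemma region_window : n.*2 <= N.
Proof. by rewrite /N /n /P /E_window; lia. Qed.

Lemma row_max_SE j : j.+2 <= y + z -> K j = 2 * (x + y + z + 3 * a - 2) + j.
Proof. by rewrite /K /E_row_max => ->. Qed.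

Lemma row_max_NE m : m <= y + z + 2 * a - 2 -> K (n.*2.-1 - m) = 2 * x + 3 * m.
Proof.
move=> le_m; rewrite /K /E_row_max region_height.
have -> : ((n.*2.-1 - m).+2 <= y + z) = false by rewrite /n /P; lia.
rewrite /n /P; lia.
Qed.

Lemma row_cases j : j < n.*2 ->
  (j.+2 <= y + z /\ K j = 2 * (x + y + z + 3 * a - 2) + j) \/
  exists2 m, m <= y + z + 2 * a - 2 & j = n.*2.-1 - m /\ K j = 2 * x + 3 * m.
Proof.
move=> lt_j; have [le_j|gt_j] := leqP j.+2 (y + z).
  by left; rewrite row_max_SE.
right; exists (n.*2.-1 - j); first by rewrite /n /P; lia.
have Ej : j = n.*2.-1 - (n.*2.-1 - j) by lia.
split=> //; rewrite {1}Ej row_max_NE //; rewrite /n /P; lia.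
Qed.

Lemma row_max_window j : j < n.*2 -> K j < N.
Proof.
by rewrite /N /E_window => /row_cases[[le_j ->]|[m le_m [_ ->]]]; lia.
Qed.

Lemma row_max_below j k :
  j.+1 < n.*2 -> odd (j.+1 + k) -> k <= K j.+1 -> k <= K j.
Proof.
move=> lt_j odd_k; have lt_j' : j < n.*2 by lia.
have [[le_j' ->]|[m' le_m' [Ej' ->]]] := row_cases lt_j'.
  have [[le_j ->]|[m le_m [Ej ->]]] := row_cases lt_j; first by lia.
  by move: Ej; rewrite /n /P; lia.
have [[le_j ->]|[m le_m [Ej ->]]] := row_cases lt_j; last by lia.
by move: Ej'; rewrite /n /P; lia.
Qed.

Lemma occupied_toothpos r :
  occupied toothpos r =
  [&& x <= r, ~~ odd (r - x) & ((r - x)./2 < P) || (q <= (r - x)./2 < q + z)].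
Proof.
apply/existsP/idP => [[i /eqP <-]|].
  have := ltn_ord i; rewrite /toothpos /teeth /n; case: ifP => lt_i lt_n.
    by rewrite leq_addr addKn mul2n odd_double doubleK lt_i.
  rewrite leq_addr addKn mul2n odd_double doubleK /=; apply/orP; right; lia.
case/and3P => le_xr ev /orP[lt_P|lt_q].
  have lt_n : (r - x)./2 < n by rewrite /n; lia.
  exists (Ordinal lt_n); rewrite /toothpos /teeth /= lt_P; lia.
have lt_n : P + ((r - x)./2 - q) < n by rewrite /n; lia.
by exists (Ordinal lt_n); rewrite /toothpos /teeth /= ltnNge leq_addr /= addKn; lia.
Qed.

Lemma toothpos_incr : {homo toothpos : i j / i < j}.
Proof.
move=> i j lt_ij; rewrite /toothpos /teeth.
by case: (ltnP i P); case: (ltnP j P); rewrite /q /P; lia.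
Qed.

Lemma toothpos_bound i : toothpos i <= n.-1 + (K 0).+1./2.
Proof.
have lt_i := ltn_ord i; have n0 : 0 < n.*2 by lia.
have le_t : teeth P q i <= y + z + 2 * a - 2.
  by move: lt_i; rewrite /teeth /n /q /P; case: ifP; lia.
rewrite /toothpos; move: (teeth P q i) le_t => t le_t.
have [[le_j ->]|[m le_m [Ej ->]]] := row_cases n0.
  by rewrite /n /P; lia.
by move: Ej; rewrite /n /P; lia.
Qed.

Lemma removed_triE (t : tri) : removed_tri x y z a t =
  [&& t.1 < n.*2, P <= n.*2.-1 - t.1 < q & t.2 == 2 * x + 3 * (n.*2.-1 - t.1)].
Proof.
case: t => j k; apply/existsP/idP => /= [[m /andP[/andP[m1 m2] /eqP[-> ->]]]|].
  by rewrite region_height; apply/and3P; move: m1 m2; rewrite /n /q /P; split; lia.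
case/and3P => lt_j /andP[m1 m2] /eqP Ek.
have lt_m : n.*2.-1 - j < y + 2 * a by move: m2; rewrite /q; lia.
exists (Ordinal lt_m); rewrite /NE_up_tri region_height /= Ek xpair_eqE eqxx andbT.
by move: m1 m2; rewrite /n /q /P; lia.
Qed.

Lemma occupied_even t :
  occupied toothpos (x + 2 * t) = (t < P) || (q <= t < q + z).
Proof.
by rewrite occupied_toothpos leq_addr addKn mul2n odd_double doubleK.
Qed.

Lemma occupied_odd t : occupied toothpos (x + (2 * t + 1)) = false.
Proof. by rewrite occupied_toothpos addKn mul2n addn1 /= odd_double !andbF. Qed.

(** An up-pointing triangle at the end of a northeastern row is kept exactly when its tooth is
    present. The horizontal boundary edges on top have numbers below [x] or of the form
    [x + 2m + 1], which are never occupied, so the down-pointing triangles under them stay. *)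
Lemma E_in_regionE (t : tri) :
  E_in_region x y z a t = trimmed n (rows n K) (occupied toothpos) t.
Proof.
case: t => j k; rewrite /E_in_region /trimmed /in_pentagon region_height -/K.
rewrite -/(rows n K (j, k)); have [/andP[/= lt_j le_k]|//] := boolP (rows n K (j, k)).
rewrite removed_triE /up_tri /rows /pos /= lt_j /=.
have n2 : n.*2 = 2 * (y + z + a) - 2 by rewrite /n /P; lia.
have Enq : q + z = y + z + 2 * a - 1 by rewrite /q; lia.
case: ifP => [odd_jk|even_jk].
  have [[le_j EK]|[m le_m [Ej EK]]] := row_cases lt_j; rewrite EK in le_k *.
    have -> : k < 2 * (x + y + z + 3 * a - 2) + j.
      rewrite ltn_neqAle le_k andbT; apply/eqP => Ek; move: odd_jk.
      by rewrite Ek addnCA addnn mul2n oddD !odd_double.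
    have -> : (n.*2.-1 - j < q) = false by rewrite /q; clear -n2 yz le_j lt_j; lia.
    by rewrite andbF.
  have -> : n.*2.-1 - j = m by clear -n2 Ej lt_j le_m yz; lia.
  move: le_k; rewrite leq_eqVlt => /orP[/eqP ->|lt_k]; last first.
    by rewrite lt_k (ltn_eqF lt_k) !andbF.
  have -> : (m + (2 * x + 3 * m))./2 = x + 2 * m by clear; lia.
  rewrite ltnn eqxx andbT occupied_even Enq.
  have -> : m < y + z + 2 * a - 1 by clear -le_m n2 lt_j yz ya; lia.
  by rewrite andbT negb_and -ltnNge -leqNgt.
have -> : (k == 2 * x + 3 * (n.*2.-1 - j)) = false.
  by clear -even_jk n2 lt_j; lia.
rewrite !andbF; apply/esym; have [lt_j1|le_j1] := ltnP j.+1 n.*2; last first.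
  have [[le_j EK]|[m le_m [Ej EK]]] := row_cases lt_j.
    by clear -le_j le_j1 n2 yz ya; lia.
  have Em : n.*2.-1 - j = 0 by clear -le_j1; lia.
  have {}Em : m = 0 by move: Em; rewrite Ej; clear -le_m n2 yz; lia.
  rewrite EK Em in le_k; rewrite occupied_toothpos (_ : x <= _ = false) //.
  by move: n2 lt_j even_jk le_j1 le_k; clear; lia.
have [[le_j' EK']|[m' le_m' [Ej' EK']]] := row_cases lt_j1; rewrite EK'.
  apply/orP; left; have [[le_j EK]|[m le_m [Ej EK]]] := row_cases lt_j.
    by rewrite EK in le_k; clear -le_k; lia.
  by clear -Ej le_m n2 le_j'; lia.
have [[le_j EK]|[m le_m [Ej EK]]] := row_cases lt_j; rewrite EK in le_k.
  by apply/orP; left; clear -le_j le_m' le_k Ej' n2; lia.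
have Em : m = m'.+1 by clear -Ej Ej' n2 le_m le_m' lt_j1 yz; lia.
have [//|lt_k] := leqP k (2 * x + 3 * m').
have Ek : k = 2 * x + 3 * m' + 2.
  rewrite Em in le_k Ej le_m; clear -Ej le_k lt_k even_jk n2 yz le_m; lia.
have -> : (n.*2.-1 - j + k)./2 = x + (2 * m' + 1).
  by clear -Ek Ej Em le_m n2 yz; lia.
by rewrite occupied_odd.
Qed.

Lemma path_counts_tooth (i c : 'I_n) :
  path_counts n K n.*2 (toothpos i) c = pathmx x c (teeth P q i).
Proof.
have lt_c := ltn_ord c; have n0 : 0 < n.*2 by lia.
have n2 : n.*2 = 2 * (y + z + a) - 2 by rewrite /n /P; lia.
have : teeth P q i <= y + z + 2 * a - 2.
  by have := ltn_ord i; rewrite /teeth /n /q /P; case: ifP; lia.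
rewrite /toothpos; move: (teeth P q i) => m le_m.
have lt_m : m < n.*2 by lia.
(* Tooth [m] lies at the end of row [n.*2.-1 - m], and the rows above end before its position, so
   its count is final once that row is processed. *)
have dead j : n.*2 - m <= j < n.*2 -> n.*2 + K j < (x + 2 * m).*2.+1 + j.
  move=> /andP[j1 j2]; have Ej : j = n.*2.-1 - (n.*2.-1 - j) by lia.
  by rewrite Ej row_max_NE; lia.
rewrite (@path_counts_dead _ _ (n.*2 - m) _ _ _ _ dead) ?leq_subr // (_ : n.*2 - m = (n.*2.-1 - m).+1); last by lia.
rewrite (path_countsS_closed row_max_below) //; [|by lia|by rewrite row_max_NE //; lia].
rewrite /free_count /pathmx; have [le_mc|lt_cm] := leqP m c.*2.+1; last first.
  have -> : (x + 2 * m == c) = false by lia.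
  by rewrite ifT //; lia.
rewrite ifF; last by lia.
have -> : (n.*2.-1 - m).+1.-1 - (n.-1 - c).*2 = c.*2.+1 - m by lia.
case: leqP => [le_c|lt_c']; last by rewrite bin_small //; lia.
by congr (_%:R)%R; congr 'C(_, _); lia.
Qed.
End Region.

Theorem theorem4p6 (x y z a : nat) :
  (1 <= y + z)%N -> (1 <= y + a)%N ->
  ((ntilings (E_region x y z a))%:R : rat) = E1 x y z a.
Proof.
move=> yz ya; rewrite E1_teethdet //.
have regionE : E_region x y z a = [set t | trimmed (y + a - 1 + z)
    (rows (y + a - 1 + z) (E_row_max x y z a)) (occupied (@toothpos x y z a)) (tri_of t)].
  by apply/setP => t; rewrite !inE E_in_regionE.
rewrite regionE -[ntilings _]/(tilings_of _ _).
rewrite tilings_trimmed; first last.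
- by move=> i; apply: toothpos_bound.
- exact: toothpos_incr.
- by apply: row_max_below.
- by apply: row_max_window.
- by apply: region_window.
rewrite /minor /teethdet -det_tr; congr (\det _)%R.
by apply/matrixP => c i; rewrite !mxE path_counts_tooth.
Qed.
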